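(* Let $\mathcal U,\mathcal Y_1,\mathcal Y$ be separable Hilbert spaces, and let $\Sigma_1=(A_1,B_1,C_1,D_1;\mathcal X_1,\mathcal U,\mathcal Y_1;\kappa_1)$ and $\Sigma_2=(A_2,B_2,C_2,D_2;\mathcal X_2,\mathcal Y_1,\mathcal Y;\kappa_2)$ be isometric and controllable realizations of the functions $S_1\in\mathbf S_{\kappa_1}(\mathcal U,\mathcal Y_1)$ and $S_2\in\mathbf S_{\kappa_2}(\mathcal Y_1,\mathcal Y)$, respectively. Then the product $\Sigma=\Sigma_2\circ\Sigma_1$ is an isometric and controllable realization of $S=S_2S_1$ if and only if the following two conditions hold: (i) $\mathcal H(S^\#)=S_1^\#\mathcal H(S_2^\#)\oplus\mathcal H(S_1^\#)$; (ii) the mapping $h_2\mapsto S_1^\#h_2$ is an isometry from $\mathcal H(S_2^\#)$ to $S_1^\#\mathcal H(S_2^\#)$.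
   Context: All spaces are complex and separable. A Pontryagin space $\mathcal X$ is a vector space with a Hermitian indefinite inner product admitting an orthogonal decomposition $\mathcal X=\mathcal X^+\oplus\mathcal X^-$, where $(\mathcal X^{\pm},\pm\langle\cdot,\cdot\rangle)$ are Hilbert spaces and $\dim\mathcal X^-<\infty$; its negative index is $\dim \mathcal X^-$. Topological notions refer to the Hilbert space topology of $\mathcal X^+\oplus(-\mathcal X^-)$; adjoints and orthogonality are with respect to the indefinite inner products. $\oplus$ denotes orthogonal direct sum. $\mathcal L(\cdot,\cdot)$ denotes continuous linear operators. Generalized Schur class: $\mathbf S_\kappa(\mathcal U,\mathcal Y)$ is the set of $\mathcal L(\mathcal U,\mathcal Y)$-valued functions $S$ meromorphic in the unit disc $\mathbb D$ and holomorphic near $0$ such that the kernel $K_S(w,z)=\frac{1-S(z)S(w)^*}{1-z\bar w}$ has $\kappa$ negative squares, i.e. every Hermitian matrix $(\langle K_S(w_j,w_i)f_j,f_i\rangle)_{i,j=1}^n$ with $w_i$ in the domain of holomorphy $\rho(S)$ and $f_i\in\mathcal Y$ has at most $\kappa$ negative eigenvalues, and some such matrix has exactly $\kappa$. A product of generalized Schur functions is a generalized Schur function. $S^\#(z)=S(\bar z)^*$; one has $S^\#\in\mathbf S_\kappa(\mathcal Y,\mathcal U)$ whenever $S\in\mathbf S_\kappa(\mathcal U,\mathcal Y)$. For a generalized Schur function $S$ with values in $\mathcal L(\mathcal U,\mathcal Y)$, $\mathcal H(S)$ is the reproducing kernel Pontryagin space (of negative index equal to the number of negative squares) of $\mathcal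 Y$-valued functions on $\rho(S)$ with kernel $K_S$: it contains all $K_S(w,\cdot)f$ and $\langle h,K_S(w,\cdot)f\rangle_{\mathcal H(S)}=\langle h(w),f\rangle_{\mathcal Y}$. Functions are identified when they agree near $0$. $S_1^\#\mathcal H(S_2^\#)=\{S_1^\#h_2:h_2\in\mathcal H(S_2^\#)\}$; in (i) and (ii) it is regarded as a subspace of $\mathcal H(S^\#)$ with the inner product of $\mathcal H(S^\#)$. System: $\Sigma=(A,B,C,D;\mathcal X,\mathcal U,\mathcal Y;\kappa)$ consists of a Pontryagin space $\mathcal X$ of negative index $\kappa$, Hilbert spaces $\mathcal U,\mathcal Y$, and a system operator $T_\Sigma=\begin{pmatrix}A&B\\ C&D\end{pmatrix}\in\mathcal L(\mathcal X\oplus\mathcal U,\mathcal X\oplus\mathcal Y)$. It is isometric if $T_\Sigma^*T_\Sigma=I$, and controllable if $\overline{\mathrm{span}}\{\mathrm{ran}\,A^{n}B:n\ge0\}=\mathcal X$. Its transfer function is $\theta_\Sigma(z)=D+zC(I-zA)^{-1}B$; $\Sigma$ is a realization of $\theta$ if $\theta_\Sigma=\theta$ near $0$. Product: $\Sigma_2\circ\Sigma_1$ is the system with state space $\mathcal X_1\oplus\mathcal X_2$, incoming space $\mathcal U$, outgoing space $\mathcal Y$, negative index $\kappa_1+\kappa_2$, main operator $\begin{pmatrix}A_1&0\\ B_2C_1&A_2\end{pmatrix}$, control operator $\begin{pmatrix}B_1\\ B_2D_1\end{pmatrix}$, observation operator $\begin{pmatrix}D_2C_1&C_2\end{pmatrix}$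 and feedthrough operator $D_2D_1$. *)

(* Defs.v *)
From HB Require Import structures.
From mathcomp Require Import all_boot all_order all_algebra.
From mathcomp Require Import complex.
From mathcomp Require Import boolp classical_sets functions cardinality reals.
From mathcomp Require Import topology normedtype.
From mathcomp Require Import ring lra.

Set Implicit Arguments.
Unset Strict Implicit.
Unset Printing Implicit Defensive.

Import Order.TTheory GRing.Theory Num.Theory.
Import numFieldNormedType.Exports.

Local Open Scope classical_set_scope.
Local Open Scope ring_scope.

(* Declaring R[i] through numClosedFieldType gives it the topology and the
   norm that the library attaches to an abstract numeric field. *)
Definition Cplx (R : realType) : numClosedFieldType := R[i]%C.

HB.saturate prod.

Lemma prod_cauchy_cvg (K : numFieldType) (V W : completeNormedModType K)
    (F : set_system (V * W)%type) :
  ProperFilter F -> cauchy F -> cvg F.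
Proof.
move=> FF /cauchy_ballP cF.
have c1 : cauchy (fst @ F).
  apply/cauchy_ballP => e e0; have := cF e e0.
  rewrite !near_simpl /= => [[[A B] /= [FA FB] sAB]].
  exists (fst @` A, fst @` B) => /=.
    split; [apply: filterS FA|apply: filterS FB] => x; by exists x.
  by move=> [_ _] /= [[x Ax <-] [y By <-]]; have [] := sAB (x, y) (conj Ax By).
have c2 : cauchy (snd @ F).
  apply/cauchy_ballP => e e0; have := cF e e0.
  rewrite !near_simpl /= => [[[A B] /= [FA FB] sAB]].
  exists (snd @` A, snd @` B) => /=.
    split; [apply: filterS FA|apply: filterS FB] => x; by exists x.
  by move=> [_ _] /= [[x Ax <-] [y By <-]]; have [] := sAB (x, y) (conj Ax By).
have /(cvg_ex (T := V))[l1 Fl1] : cvg (fst @ F) by exact: cauchy_cvg.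
have /(cvg_ex (T := W))[l2 Fl2] : cvg (snd @ F) by exact: cauchy_cvg.
apply/cvg_ex; exists (l1, l2) => /=.
have := cvg_pair Fl1 Fl2.
have -> : (fun x : V * W => (x.1, x.2)) = id by apply/funext => -[].
by apply.
Qed.

HB.instance Definition _ (K : numFieldType) (V W : completeNormedModType K) :=
  Uniform_isComplete.Build (V * W)%type (@prod_cauchy_cvg K V W).

Definition sum_form (R : realType) (V W : lmodType (Cplx R))
    (g : {hermitian V for false & @Num.conj (Cplx R)})
    (h : {hermitian W for false & @Num.conj (Cplx R)})
    (x y : (V * W)%type) : Cplx R :=
  g x.1 y.1 + h x.2 y.2.

Lemma sum_form_bilinear (R : realType) (V W : lmodType (Cplx R))
    (g : {hermitian V for false & @Num.conj (Cplx R)})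
    (h : {hermitian W for false & @Num.conj (Cplx R)}) :
  bilinear_for ( *%R ) (@Num.conj (Cplx R) \; *%R) (sum_form g h).
Proof.
split=> [y|x] a u v; rewrite /sum_form /=.
  by rewrite !linearPl /=; ring.
by rewrite !linearPr /=; ring.
Qed.

HB.instance Definition _ (R : realType) (V W : lmodType (Cplx R))
    (g : {hermitian V for false & @Num.conj (Cplx R)})
    (h : {hermitian W for false & @Num.conj (Cplx R)}) :=
  bilinear_isBilinear.Build (Cplx R) _ _ _
    (GRing.Scale.Law.clone _ _ ( *%R ) _)
    (GRing.Scale.Law.clone _ _ (@Num.conj (Cplx R) \; *%R) _)
    (sum_form g h) (sum_form_bilinear g h).

Lemma sum_form_hermitian (R : realType) (V W : lmodType (Cplx R))
    (g : {hermitian V for false & @Num.conj (Cplx R)})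
    (h : {hermitian W for false & @Num.conj (Cplx R)}) x y :
  sum_form g h x y = (-1) ^+ false * Num.conj (sum_form g h y x).
Proof.
rewrite expr0 mul1r /sum_form rmorphD /=; congr (_ + _).
  by rewrite hermitian_subproof expr0 mul1r.
by rewrite hermitian_subproof expr0 mul1r.
Qed.

HB.instance Definition _ (R : realType) (V W : lmodType (Cplx R))
    (g : {hermitian V for false & @Num.conj (Cplx R)})
    (h : {hermitian W for false & @Num.conj (Cplx R)}) :=
  isHermitianSesquilinear.Build _ _ _ _ (sum_form g h) (sum_form_hermitian g h).

Definition subspace (R : realType) (V : lmodType (Cplx R)) (E : set V) : Prop :=
  E 0 /\ forall (a : Cplx R) x y, E x -> E y -> E (a *: x + y).

Definition lspan (R : realType) (V : lmodType (Cplx R)) (E : set V) : set V :=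
  [set x | exists (n : nat) (a : 'I_n -> Cplx R) (v : 'I_n -> V),
     (forall i, E (v i)) /\ x = \sum_(i < n) a i *: v i].

Definition has_dim (R : realType) (V : lmodType (Cplx R)) (E : set V)
    (k : nat) : Prop :=
  exists b : 'I_k -> V,
    (forall a : 'I_k -> Cplx R,
       \sum_(i < k) a i *: b i = 0 -> forall i, a i = 0) /\
    (forall x, E x <-> exists a : 'I_k -> Cplx R, x = \sum_(i < k) a i *: b i).

Definition separable (T : topologicalType) : Prop :=
  exists D : set T, countable D /\ dense D.

(* V = Vp (+) Vm orthogonally, dim Vm = k, and (Vp, g), (Vm, -g) are Hilbert
   spaces whose orthogonal sum has the topology of V.  The bounds say that
   g(x+,x+) - g(x-,x-) is the square of a norm equivalent to the norm of V;
   they contain the definiteness of g on Vp and of -g on Vm, and, V being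
   complete, the completeness of both summands. *)
Definition fundamental_decomposition (R : realType)
    (V : completeNormedModType (Cplx R)) (g : V -> V -> Cplx R) (k : nat)
    (Vp Vm : set V) : Prop :=
  [/\ subspace Vp /\ subspace Vm,
      forall x, exists xp xm, [/\ Vp xp, Vm xm & x = xp + xm],
      forall xp xm, Vp xp -> Vm xm -> g xp xm = 0,
      has_dim Vm k
    & exists c d : Cplx R, [/\ 0 < c, 0 < d
      & forall xp xm, Vp xp -> Vm xm ->
          c * `|xp + xm| ^+ 2 <= g xp xp - g xm xm /\
          g xp xp - g xm xm <= d * `|xp + xm| ^+ 2]].

(* The norm of the carrier is an auxiliary choice among the equivalent norms
   given by the fundamental decompositions and is not required to be one of
   them: the carrier of an orthogonal sum has the maximum norm. *)
Record pontryagin (R : realType) : Type := Pontryagin {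
  pcarrier :> completeNormedModType (Cplx R);
  pform : {hermitian pcarrier for false & @Num.conj (Cplx R)};
  neg_index : nat;
  pontryaginP : exists Vp Vm : set pcarrier,
    fundamental_decomposition pform neg_index Vp Vm;
  pontryagin_separable : separable pcarrier }.

Arguments pform {R} p : rename.
Arguments neg_index {R} p : rename.

Notation "''[' x , y ]" := (pform _ x y) : ring_scope.

Record hilbert (R : realType) : Type := Hilbert {
  hpontryagin :> pontryagin R;
  hilbert_index : neg_index hpontryagin = 0%N;
  hilbert_norm : forall x : hpontryagin, '[x, x] = `|x| ^+ 2 }.

Lemma subspace_sum (R : realType) (V W : lmodType (Cplx R)) (E : set V)
    (F : set W) :
  subspace E -> subspace F -> @subspace R (V * W)%type [set x | E x.1 /\ F x.2].
Proof.
move=> [E0 sE] [F0 sF]; split=> // a x y [x1 x2] [y1 y2].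
by split; [exact: sE|exact: sF].
Qed.

Lemma has_dim_sum (R : realType) (V W : lmodType (Cplx R)) (E : set V)
    (F : set W) (k l : nat) :
  has_dim E k -> has_dim F l ->
  has_dim [set x : (V * W)%type | E x.1 /\ F x.2] (k + l).
Proof.
move=> [b [bfree bE]] [c [cfree cF]].
pose e (i : 'I_(k + l)) : (V * W)%type :=
  match fintype.split i with inl j => (b j, 0) | inr j => (0, c j) end.
have sumE (a : 'I_(k + l) -> Cplx R) : \sum_i a i *: e i =
    (\sum_i a (lshift l i) *: b i, \sum_i a (rshift k i) *: c i).
  rewrite [LHS]surjective_pairing; congr pair.
    rewrite (big_morph fst (id1 := 0) (op1 := +%R)) // big_split_ord /=.
    rewrite [X in _ + X]big1 => [|i _]; last first.
      by rewrite /e (unsplitK (inr _)) scaler0.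
    by rewrite addr0; apply: eq_bigr => i _; rewrite /e (unsplitK (inl _)).
  rewrite (big_morph snd (id1 := 0) (op1 := +%R)) // big_split_ord /=.
  rewrite [X in X + _]big1 => [|i _]; last first.
    by rewrite /e (unsplitK (inl _)) scaler0.
  by rewrite add0r; apply: eq_bigr => i _; rewrite /e (unsplitK (inr _)).
exists e; split=> [a|[x y]].
  rewrite sumE => -[/bfree a1 /cfree a2] i.
  by rewrite -(splitK i); case: (fintype.split i) => j /=.
split=> [[/= /bE[a1 ->] /cF[a2 ->]]|[a]].
  exists (fun i => match fintype.split i with inl j => a1 j | inr j => a2 j end).
  rewrite sumE; congr pair; apply: eq_bigr => i _.
    by rewrite (unsplitK (inl _)).
  by rewrite (unsplitK (inr _)).
rewrite sumE => -[-> ->]; split=> /=.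
  by apply/bE; exists (a \o lshift l).
by apply/cF; exists (a \o @rshift k l).
Qed.

Lemma separable_prod (S T : topologicalType) :
  separable S -> separable T -> separable (S * T)%type.
Proof.
move=> [D [cD dD]] [E [cE dE]]; exists (D `*` E); split; first exact: countableX.
move=> O [[x y] Oxy] oO.
have : nbhs (x, y) O by exact: open_nbhs_nbhs.
move=> [[A B] /= [nA nB] sAB].
have [x' [/interior_subset Ax' Dx']] : A° `&` D !=set0.
  by apply: dD; [exists x|exact: open_interior].
have [y' [/interior_subset By' Ey']] : B° `&` E !=set0.
  by apply: dE; [exists y|exact: open_interior].
by exists (x', y'); split => //; exact: sAB.
Qed.

Lemma fundamental_decomposition_sum (R : realType)
    (V W : completeNormedModType (Cplx R))
    (g : {hermitian V for false & @Num.conj (Cplx R)})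
    (h : {hermitian W for false & @Num.conj (Cplx R)})
    (k l : nat) (Vp Vm : set V) (Wp Wm : set W) :
  fundamental_decomposition g k Vp Vm ->
  fundamental_decomposition h l Wp Wm ->
  @fundamental_decomposition R (V * W)%type (sum_form g h) (k + l)
    [set x | Vp x.1 /\ Wp x.2] [set x | Vm x.1 /\ Wm x.2].
Proof.
move=> [[sVp sVm] dV oV nV [c1 [d1 [c10 d10 bV]]]].
move=> [[sWp sWm] dW oW nW [c2 [d2 [c20 d20 bW]]]]; split.
- by split; exact: subspace_sum.
- move=> [x y]; have [xp [xm [? ? ->]]] := dV x; have [yp [ym [? ? ->]]] := dW y.
  by exists (xp, yp), (xm, ym); split.
- move=> [xp yp] [xm ym] /= [? ?] [? ?].
  by rewrite /sum_form /= oV // oW // addr0.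
- exact: has_dim_sum.
have c0 : 0 < c1 + c2 by rewrite addr_gt0.
exists (c1 * c2 / (c1 + c2)), (d1 + d2); split.
- by rewrite divr_gt0 // mulr_gt0.
- by rewrite addr_gt0.
move=> [xp yp] [xm ym] /= [Vxp Wyp] [Vxm Wym]; rewrite /sum_form /=.
have [lV uV] := bV _ _ Vxp Vxm; have [lW uW] := bW _ _ Wyp Wym.
have -> : g xp xp + h yp yp - (g xm xm + h ym ym) =
  (g xp xp - g xm xm) + (h yp yp - h ym ym) by ring.
set q1 := g xp xp - _ in lV uV *; set q2 := h yp yp - _ in lW uW *.
have le1 : c1 * c2 / (c1 + c2) <= c1.
  by rewrite ler_pdivrMr // ler_pM2l // lerDr ltW.
have le2 : c1 * c2 / (c1 + c2) <= c2.
  by rewrite ler_pdivrMr // mulrC ler_pM2l // lerDl ltW.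
rewrite [`|_|]/(Num.max _ _) /=.
set A := `|xp + xm| in lV uV *; set B := `|yp + ym| in lW uW *.
have A2 : 0 <= A ^+ 2 by rewrite exprn_ge0 // normr_ge0.
have B2 : 0 <= B ^+ 2 by rewrite exprn_ge0 // normr_ge0.
have q10 : 0 <= q1 by apply: le_trans lV; rewrite mulr_ge0 // ltW.
have q20 : 0 <= q2 by apply: le_trans lW; rewrite mulr_ge0 // ltW.
have /orP[AB|BA] : (A <= B) || (B <= A).
- by apply: real_leVge; exact: normr_real.
- rewrite -/(Num.max A B) (max_r AB); split.
    apply: le_trans (_ : q2 <= _); last by rewrite lerDr.
    by apply: le_trans lW; rewrite ler_wpM2r.
  rewrite mulrDl lerD //; apply: le_trans uV _.
  by rewrite ler_wpM2l ?(ltW d10) // lerXn2r // nnegrE normr_ge0.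
- rewrite -/(Num.max A B) (max_l BA); split.
    apply: le_trans (_ : q1 <= _); last by rewrite lerDl.
    by apply: le_trans lV; rewrite ler_wpM2r.
  rewrite mulrDl lerD //; apply: le_trans uW _.
  by rewrite ler_wpM2l ?(ltW d20) // lerXn2r // nnegrE normr_ge0.
Qed.

Lemma psum_subproof (R : realType) (X Y : pontryagin R) :
  exists Vp Vm : set (X * Y)%type,
    @fundamental_decomposition R (X * Y)%type (sum_form (pform X) (pform Y))
      (neg_index X + neg_index Y) Vp Vm.
Proof.
have [Vp [Vm fV]] := pontryaginP X; have [Wp [Wm fW]] := pontryaginP Y.
exists [set x | Vp x.1 /\ Wp x.2], [set x | Vm x.1 /\ Wm x.2].
exact: fundamental_decomposition_sum.
Qed.

Definition psum (R : realType) (X Y : pontryagin R) : pontryagin R :=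
  @Pontryagin R (X * Y)%type (sum_form (pform X) (pform Y))
    (neg_index X + neg_index Y) (psum_subproof X Y)
    (separable_prod (pontryagin_separable X) (pontryagin_separable Y)).

(* The elements of L(V, W). *)
Definition bop (R : realType) (V W : normedModType (Cplx R)) (T : V -> W) :=
  linear T /\ continuous T.

(* adjoint T y is the vector x with '[T x', y] = '[x', x] for all x'; it is
   unique because the form is nondegenerate, and it exists for T in L(X, Y). *)
Definition adjoint (R : realType) (X Y : pontryagin R) (T : X -> Y) : Y -> X :=
  fun y => xget 0 [set x | forall x', '[T x', y] = '[x', x]].

Definition inverse (R : realType) (V : normedModType (Cplx R)) (T : V -> V) :
  V -> V := fun y => xget 0 [set x | T x = y].

Record system (R : realType) (X : pontryagin R) (U Y : hilbert R) : Type :=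
  System {
    main_op : X -> X;
    control_op : U -> X;
    observation_op : X -> Y;
    feedthrough_op : U -> Y;
    main_opP : bop main_op;
    control_opP : bop control_op;
    observation_opP : bop observation_op;
    feedthrough_opP : bop feedthrough_op }.

Definition system_operator (R : realType) (X : pontryagin R) (U Y : hilbert R)
    (Sigma : system X U Y) : psum X U -> psum X Y :=
  fun v => (main_op Sigma v.1 + control_op Sigma v.2,
            observation_op Sigma v.1 + feedthrough_op Sigma v.2).

Definition isometric (R : realType) (X : pontryagin R) (U Y : hilbert R)
    (Sigma : system X U Y) : Prop :=
  adjoint (system_operator Sigma) \o system_operator Sigma = id.

Definition controllable (R : realType) (X : pontryagin R) (U Y : hilbert R)
    (Sigma : system X U Y) : Prop :=
  closure (lspan [set x | exists (n : nat) (u : U),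
                   x = iter n (main_op Sigma) (control_op Sigma u)])
  = [set: X].

Definition transfer (R : realType) (X : pontryagin R) (U Y : hilbert R)
    (Sigma : system X U Y) (z : Cplx R) : U -> Y :=
  fun u => feedthrough_op Sigma u +
    z *: observation_op Sigma
           (inverse (fun x => x - z *: main_op Sigma x) (control_op Sigma u)).

Definition realizes (R : realType) (X : pontryagin R) (U Y : hilbert R)
    (Sigma : system X U Y) (theta : Cplx R -> U -> Y) : Prop :=
  \forall z \near (0 : Cplx R), transfer Sigma z = theta z.

Lemma bop_comp (R : realType) (V W Z : normedModType (Cplx R))
    (T : W -> Z) (T' : V -> W) : bop T -> bop T' -> bop (T \o T').
Proof.
move=> [lT cT] [lT' cT']; split=> [a x y /=|]; first by rewrite lT' lT.
by move=> x; apply: continuous_comp; [exact: cT'|exact: cT].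
Qed.

Lemma bop_add (R : realType) (V W : normedModType (Cplx R))
    (T T' : V -> W) : bop T -> bop T' -> bop (fun x => T x + T' x).
Proof.
move=> [lT cT] [lT' cT']; split=> [a x y /=|].
  by rewrite lT' lT scalerDr addrACA.
by move=> x; apply: cvgD; [exact: cT|exact: cT'].
Qed.

Lemma bop_pair (R : realType) (V W Z : normedModType (Cplx R))
    (T : V -> W) (T' : V -> Z) :
  bop T -> bop T' -> @bop R V (W * Z)%type (fun x => (T x, T' x)).
Proof.
move=> [lT cT] [lT' cT']; split=> [a x y /=|]; first by rewrite lT lT'.
by move=> x; apply: cvg_pair; [exact: cT|exact: cT'].
Qed.

Lemma bop_fst (R : realType) (V W : normedModType (Cplx R)) :
  @bop R (V * W)%type V fst.
Proof. by split=> // x; exact: cvg_fst. Qed.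

Lemma bop_snd (R : realType) (V W : normedModType (Cplx R)) :
  @bop R (V * W)%type W snd.
Proof. by split=> // x; exact: cvg_snd. Qed.

Definition product_system (R : realType) (X1 X2 : pontryagin R)
    (U Y1 Y : hilbert R) (Sigma2 : system X2 Y1 Y) (Sigma1 : system X1 U Y1) :
  system (psum X1 X2) U Y.
Proof.
refine (@System R (psum X1 X2) U Y
  (fun x => (main_op Sigma1 x.1,
     control_op Sigma2 (observation_op Sigma1 x.1) + main_op Sigma2 x.2))
  (fun u => (control_op Sigma1 u, control_op Sigma2 (feedthrough_op Sigma1 u)))
  (fun x => feedthrough_op Sigma2 (observation_op Sigma1 x.1)
     + observation_op Sigma2 x.2)
  (fun u => feedthrough_op Sigma2 (feedthrough_op Sigma1 u)) _ _ _ _).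
- apply: bop_pair; first exact: bop_comp (main_opP _) (bop_fst _ _).
  apply: bop_add; last exact: bop_comp (main_opP _) (bop_snd _ _).
  apply: bop_comp (control_opP _) _.
  exact: bop_comp (observation_opP _) (bop_fst _ _).
- apply: bop_pair; first exact: control_opP.
  exact: bop_comp (control_opP _) (feedthrough_opP _).
- apply: bop_add; last exact: bop_comp (observation_opP _) (bop_snd _ _).
  apply: bop_comp (feedthrough_opP _) _.
  exact: bop_comp (observation_opP _) (bop_fst _ _).
- exact: bop_comp (feedthrough_opP _) (feedthrough_opP _).
Defined.

(* Operator functions are total; their values outside the domain of
   holomorphy carry no information and need not be operators. *)

(* Complex differentiability in the operator norm. *)
Definition op_derivable (R : realType) (U Y : hilbert R)
    (S : Cplx R -> U -> Y) (z : Cplx R) : Prop :=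
  exists T : U -> Y, bop T /\
    forall e : Cplx R, 0 < e -> \forall w \near z, forall u,
      `|S w u - S z u - (w - z) *: T u| <= e * `|w - z| * `|u|.

Definition holomorphic_at (R : realType) (U Y : hilbert R)
    (S : Cplx R -> U -> Y) (z : Cplx R) : Prop :=
  \forall w \near z, bop (S w) /\ op_derivable S w.

Definition meromorphic (R : realType) (U Y : hilbert R)
    (S : Cplx R -> U -> Y) : Prop :=
  forall z : Cplx R, `|z| < 1 ->
    exists (n : nat) (T : Cplx R -> U -> Y), holomorphic_at T z /\
      \forall w \near z^', forall u, S w u = (w - z) ^- n *: T w u.

Definition rho (R : realType) (U Y : hilbert R) (S : Cplx R -> U -> Y) :
  set (Cplx R) := [set z | `|z| < 1 /\ holomorphic_at S z].

Definition schur_kernel (R : realType) (U Y : hilbert R)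
    (S : Cplx R -> U -> Y) (w z : Cplx R) : Y -> Y :=
  fun f => (1 - z * w^* )^-1 *: (f - S z (adjoint (S w) f)).

(* For a Hermitian matrix spectral_diag lists the eigenvalues with their
   multiplicities. *)
Definition neg_eigenvalues (C : numClosedFieldType) (n : nat) (A : 'M[C]_n) :
  nat := #|[set i | spectral_diag A 0 i < 0]%SET|.

Definition kernel_matrix (R : realType) (Y : hilbert R)
    (K : Cplx R -> Cplx R -> Y -> Y) (n : nat) (w : 'I_n -> Cplx R)
    (f : 'I_n -> Y) : 'M[Cplx R]_n :=
  \matrix_(i < n, j < n) '[K (w j) (w i) (f j), f i].

Definition has_neg_squares (R : realType) (Y : hilbert R)
    (K : Cplx R -> Cplx R -> Y -> Y) (D : set (Cplx R)) (k : nat) : Prop :=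
  (forall (n : nat) (w : 'I_n -> Cplx R) (f : 'I_n -> Y),
     (forall i, D (w i)) -> (neg_eigenvalues (kernel_matrix K w f) <= k)%N) /\
  (exists (n : nat) (w : 'I_n -> Cplx R) (f : 'I_n -> Y),
     (forall i, D (w i)) /\ neg_eigenvalues (kernel_matrix K w f) = k).

Definition gen_schur (R : realType) (U Y : hilbert R) (k : nat)
    (S : Cplx R -> U -> Y) : Prop :=
  [/\ meromorphic S, holomorphic_at S 0
    & has_neg_squares (schur_kernel S) (rho S) k].

Definition sharp (R : realType) (U Y : hilbert R) (S : Cplx R -> U -> Y) :
  Cplx R -> Y -> U := fun z => adjoint (S z^*).

(* A Pontryagin space of functions on rho S with reproducing kernel
   schur_kernel S: the function represented by h is the restriction of
   rk_eval h to rho S. *)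
Record rkps (R : realType) (U Y : hilbert R) (S : Cplx R -> U -> Y) : Type :=
  Rkps {
    rk_space :> pontryagin R;
    rk_eval : rk_space -> Cplx R -> Y;
    rk_eval_linear : forall z, rho S z -> linear (fun h => rk_eval h z);
    rk_eval_inj : forall h h',
      (forall z, rho S z -> rk_eval h z = rk_eval h' z) -> h = h';
    rk_reproducing : forall w f, rho S w -> exists k : rk_space,
      (forall z, rho S z -> rk_eval k z = schur_kernel S w z f) /\
      (forall h, '[h, k] = '[rk_eval h w, f]);
    rk_neg_index : has_neg_squares (schur_kernel S) (rho S)
      (neg_index rk_space) }.

Definition has_germ (R : realType) (U Y : hilbert R) (S : Cplx R -> U -> Y)
    (H : rkps S) (h : H) (f : Cplx R -> Y) : Prop :=
  \forall z \near (0 : Cplx R), rk_eval h z = f z.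

Definition mul_fun (R : realType) (U Y : hilbert R) (S : Cplx R -> U -> Y)
  (f : Cplx R -> U) : Cplx R -> Y := fun z => S z (f z).

Definition orthogonal_sum (R : realType) (X : pontryagin R) (M N : set X) :
  Prop :=
  [/\ forall m n, M m -> N n -> '[m, n] = 0,
      forall x, M x -> N x -> x = 0
    & forall x, exists m n, [/\ M m, N n & x = m + n]].

(* H(S#) = S1# H(S2#) (+) H(S1#), where S1# H(S2#) carries the inner product
   of H(S#) and H(S1#) its own: both consist of elements of H(S#), the inner
   products of H(S1#) and H(S#) agree on H(S1#), and H(S#) is the orthogonal
   direct sum of the two subspaces. *)
Definition space_decomposition (R : realType) (U Y1 Y : hilbert R)
    (S : Cplx R -> U -> Y) (S1 : Cplx R -> U -> Y1) (S2 : Cplx R -> Y1 -> Y)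
    (H : rkps (sharp S)) (H1 : rkps (sharp S1)) (H2 : rkps (sharp S2)) : Prop :=
  [/\ forall h2 : H2,
        exists h : H, has_germ h (mul_fun (sharp S1) (rk_eval h2)),
      forall h1 : H1, exists h : H, has_germ h (rk_eval h1),
      forall (h1 h1' : H1) (h h' : H),
        has_germ h (rk_eval h1) -> has_germ h' (rk_eval h1') ->
        '[h, h'] = '[h1, h1']
    & orthogonal_sum
        [set h : H | exists h2 : H2,
           has_germ h (mul_fun (sharp S1) (rk_eval h2))]
        [set h : H | exists h1 : H1, has_germ h (rk_eval h1)]].

Definition multiplication_isometry (R : realType) (U Y1 Y : hilbert R)
    (S : Cplx R -> U -> Y) (S1 : Cplx R -> U -> Y1) (S2 : Cplx R -> Y1 -> Y)
    (H : rkps (sharp S)) (H2 : rkps (sharp S2)) : Prop :=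
  forall (h2 h2' : H2) (h h' : H),
    has_germ h (mul_fun (sharp S1) (rk_eval h2)) ->
    has_germ h' (mul_fun (sharp S1) (rk_eval h2')) ->
    '[h, h'] = '[h2, h2'].

Arguments space_decomposition {R U Y1 Y S S1 S2} H H1 H2.
Arguments multiplication_isometry {R U Y1 Y S} S1 {S2} H H2.

(* Main.v *)
(* A controllable isometric realization Sigma of theta is unitarily equivalent to
   H(theta#): since T_Sigma maps (w^* e_w u, u) to (e_w u, theta(w^* ) u), where
   e_w u = (I - w^* A)^-1 B u, the Gram matrix of the states e_w u is the kernel
   of theta#, and e_w u |-> k_w u extends to a unitary J with
   <(J x)(z), u> = <x, e_z u>.  The states of the product are
   (e1_w u, e2_w S1(w^* ) u), so that (x1, x2) corresponds to the function
   J1 x1 + S1# J2 x2.  If the product is controllable, this is a unitary onto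
   H(S#), which gives (i) and (ii).  Conversely, a vector orthogonal to all states
   satisfies J1 x1 + S1# J2 x2 = 0, and by (i) and (ii) both summands vanish.

   The unitary J requires that functions in H(theta#) vanishing near 0 vanish
   identically.  This is proved from the kernel alone, without complex analysis,
   by means of the adjoint A of the backward shift, which satisfies
   <A x, A x> <= <x, x>. *)
Require Import Defs.
From HB Require Import structures.
From mathcomp Require Import all_boot all_order all_algebra.
From mathcomp Require Import complex.
From mathcomp Require Import boolp classical_sets reals topology normedtype.
From mathcomp Require Import ring lra.

Set Implicit Arguments.
Unset Strict Implicit.
Unset Printing Implicit Defensive.

Import Order.TTheory GRing.Theory Num.Theory.
Import numFieldNormedType.Exports.

Local Open Scope classical_set_scope.
Local Open Scope ring_scope.

(** * Real norms *)

Section RealNorm.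
Variable R : realType.
Notation C := (Cplx R).

(** The product of isometric systems is always isometric and its transfer function is always the
    product, so only controllability is at stake; [controllableP] turns it into the triviality of an
    orthogonal complement. The obstacle is indefiniteness. A densely defined isometric map need not
    be continuous: for an unbounded functional phi, x |-> (x, phi(x), phi(x)) is isometric into a
    space with one extra positive and one extra negative dimension. Continuity is recovered when the
    negative indices agree, by measuring vectors with [nb], which uses only values of the form
    against a maximal negative family. The family is taken inside the dense domain, so an isometric
    map carries it, and with it [nb], to the other space. The equality of the indices of a state
    space and of its model is not taken from the Schur class: a maximal negative family is
    transported in each direction, and the two inequalities are combined. *)

Definition re (z : C) : R := complex.Re (z : R[i]%C).
Definition rc (r : R) : C := (r%:C)%C.

Lemma reD (x y : C) : re (x + y) = re x + re y.
Proof. by case: x y => [a b] [c d]. Qed.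

Lemma reN (x : C) : re (- x) = - re x.
Proof. by case: x. Qed.

Lemma rcK (r : R) : re (rc r) = r.
Proof. by []. Qed.

Lemma rcI : injective rc.
Proof. exact: (@complexI R). Qed.

Lemma rc0 : rc 0 = 0.
Proof. by []. Qed.

Lemma rcD (r s : R) : rc (r + s) = rc r + rc s.
Proof. exact: (rmorphD (real_complex R)). Qed.

Lemma rcM (r s : R) : rc (r * s) = rc r * rc s.
Proof. exact: (rmorphM (real_complex R)). Qed.

Lemma rcN (r : R) : rc (- r) = - rc r.
Proof. exact: (rmorphN (real_complex R)). Qed.

Lemma rcV (r : R) : rc r^-1 = (rc r)^-1.
Proof. exact: (fmorphV (real_complex R)). Qed.

Lemma rcX (r : R) n : rc (r ^+ n) = rc r ^+ n.
Proof. exact: (rmorphXn (real_complex R)). Qed.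

Lemma le_rc (r s : R) : (rc r <= rc s) = (r <= s).
Proof. exact: lecR. Qed.

Lemma lt_rc (r s : R) : (rc r < rc s) = (r < s).
Proof. exact: ltcR. Qed.

Lemma rc_eq0 (r : R) : (rc r == 0) = (r == 0).
Proof. exact: (fmorph_eq0 (real_complex R)). Qed.

Lemma realE (z : C) : z \is Num.real -> z = rc (re z).
Proof. by move=> h; rewrite /rc RRe_real. Qed.

Lemma ge0E (z : C) : 0 <= z -> z = rc (re z).
Proof. by move=> h; apply: realE; exact: ger0_real. Qed.

Lemma re_conj (z : C) : re (z^*) = re z.
Proof.
by case: z.
Qed.

(** The order of [Cplx R] is partial; norms are read as real numbers so that [lra] and [nra]
    apply. *)
Definition rn (V : normedZmodType C) (x : V) : R := re `|x|.

Lemma rc_sum n (F : 'I_n -> R) : rc (\sum_i F i) = \sum_i rc (F i).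
Proof. exact: (rmorph_sum (real_complex R)). Qed.

Lemma rnE (V : normedZmodType C) (x : V) : `|x| = rc (rn x).
Proof. exact: ge0E. Qed.

Lemma rn_ge0 (V : normedZmodType C) (x : V) : 0 <= rn x.
Proof. by rewrite -le_rc -rnE normr_ge0. Qed.

Lemma rnN (V : normedZmodType C) (x : V) : rn (- x) = rn x.
Proof. by rewrite /rn normrN. Qed.

Lemma rnBC (V : normedZmodType C) (x y : V) : rn (x - y) = rn (y - x).
Proof. by rewrite /rn distrC. Qed.

Lemma rn0 (V : normedZmodType C) : rn (0 : V) = 0.
Proof. by rewrite /rn normr0. Qed.

Lemma rn_eq0 (V : normedZmodType C) (x : V) : (rn x == 0) = (x == 0).
Proof. by rewrite -rc_eq0 -rnE normr_eq0. Qed.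

Lemma rn_gt0 (V : normedZmodType C) (x : V) : (0 < rn x) = (x != 0).
Proof. by rewrite lt_neqAle rn_ge0 andbT eq_sym rn_eq0. Qed.

Lemma rnD (V : normedZmodType C) (x y : V) : rn (x + y) <= rn x + rn y.
Proof. by rewrite -le_rc rcD -!rnE ler_normD. Qed.

Lemma rnB (V : normedZmodType C) (x y : V) : rn (x - y) <= rn x + rn y.
Proof. by rewrite (le_trans (rnD _ _)) // rnN. Qed.

Lemma rn_sum (V : normedZmodType C) n (x : 'I_n -> V) :
  rn (\sum_i x i) <= \sum_i rn (x i).
Proof.
elim: n x => [|n IH] x; first by rewrite !big_ord0 rn0.
rewrite !big_ord_recr /=; apply: le_trans (rnD _ _) _.
by rewrite lerD2r IH.
Qed.

Lemma rnZ (V : normedModType C) (a : C) (x : V) : rn (a *: x) = rn a * rn x.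
Proof. by apply: rcI; rewrite rcM -!rnE normrZ. Qed.

Lemma rnM (a b : C) : rn (a * b) = rn a * rn b.
Proof. by apply: rcI; rewrite rcM -!rnE normrM. Qed.

Lemma rnX (a : C) n : rn (a ^+ n) = rn a ^+ n.
Proof. by apply: rcI; rewrite rcX -!rnE normrX. Qed.

Lemma rnV (a : C) : rn a^-1 = (rn a)^-1.
Proof. by apply: rcI; rewrite rcV -!rnE normfV. Qed.

Lemma rn1 : rn (1 : C) = 1.
Proof. by rewrite /rn normr1. Qed.

Lemma rn_i : rn ('i : C) = 1.
Proof. by rewrite /rn normCi. Qed.

Lemma conjM (a b : C) : (a * b)^* = a^* * b^*.
Proof. exact: rmorphM. Qed.

Lemma conjD (a b : C) : (a + b)^* = a^* + b^*.
Proof. exact: rmorphD. Qed.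

Lemma conjB (a b : C) : (a - b)^* = a^* - b^*.
Proof. exact: rmorphB. Qed.

Lemma conj_sum n (F : 'I_n -> C) : (\sum_i F i)^* = \sum_i (F i)^*.
Proof. exact: rmorph_sum. Qed.

Lemma rc1 : rc 1 = 1.
Proof. by []. Qed.

Lemma rc_nat n : rc n%:R = n%:R.
Proof. exact: (rmorph_nat (real_complex R)). Qed.

Lemma rn_conj (a : C) : rn a^* = rn a.
Proof. by rewrite /rn norm_conjC. Qed.

Lemma rn_rc (r : R) : 0 <= r -> rn (rc r) = r.
Proof. by move=> r0; rewrite /rn ger0_norm // -rc0 le_rc. Qed.

Lemma mul_conj (a : C) : a * a^* = rc (rn a ^+ 2).
Proof. by rewrite -normCK rnE rcX. Qed.

Lemma re_le (a : C) : re a <= rn a.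
Proof.
rewrite -le_rc -rnE; apply: le_trans (normc_ge_Re a).
by rewrite le_rc ler_norm.
Qed.

(** The imaginary part is written with a factor ['i] because such a factor can be moved into the
    first argument of the form. *)
Lemma rn_le_re_im (a : C) : rn a <= `|re a| + `|re (a * 'i)|.
Proof.
case: a => x y; rewrite /rn normc_def /re /=.
rewrite mulr0 mulr1 sub0r normrN.
rewrite -[leRHS]ger0_norm ?addr_ge0 // -sqrtr_sqr ler_wsqrtr //.
by rewrite sqrrD !real_normK ?num_real // lerD2r lerDl mulrn_wge0 // mulr_ge0.
Qed.

Lemma nbhs_rn (V : normedModType C) (x : V) (P : set V) :
  nbhs x P <-> exists2 e : R, 0 < e & forall y, rn (y - x) < e -> P y.
Proof.
rewrite -nbhs_ballE; split => [[e /= e0 H]|[e e0 H]].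
  exists (re e); first by rewrite -lt_rc -ge0E // ltW.
  move=> y; rewrite -lt_rc -rnE -ge0E ?(ltW e0) // => h.
  by apply: H; rewrite -ball_normE /= distrC.
exists (rc e); first by rewrite /= lt_rc.
move=> y; rewrite -ball_normE /= distrC rnE lt_rc; exact: H.
Qed.

Lemma closure_rn (V : normedModType C) (D : set V) (x : V) :
  closure D x <-> forall e : R, 0 < e -> exists2 y, D y & rn (y - x) < e.
Proof.
split=> [cD e e0|H B /nbhs_rn[e e0 eB]].
  have /cD[y [Dy By]] : nbhs x [set y | rn (y - x) < e].
    by apply/nbhs_rn; exists e.
  by exists y.
by have [y Dy /eB By] := H e e0; exists y.
Qed.

Definition lim_seq (V : normedModType C) (u : nat -> V) (l : V) :=
  forall e : R, 0 < e -> exists N, forall n, (N <= n)%N -> rn (u n - l) < e.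

Lemma lim_seq_cauchy (V : completeNormedModType C) (u : nat -> V) :
  (forall e : R, 0 < e -> exists N, forall n m,
     (N <= n)%N -> (N <= m)%N -> rn (u n - u m) < e) ->
  exists l, lim_seq u l.
Proof.
move=> H.
have : cauchy (u @ \oo).
  apply/cauchy_ballP => e e0; have e0' : 0 < re e.
    by rewrite -lt_rc -ge0E // ltW.
  have [N HN] := H _ e0'.
  exists (u @` [set n | (N <= n)%N], u @` [set n | (N <= n)%N]) => /=.
    by split; exists N => // n /= Nn; exists n.
  move=> [_ _] /= [[n Nn <-] [m Nm <-]].
  rewrite -ball_normE /= rnE (ge0E (ltW e0)) lt_rc.
  exact: HN.
move=> /cauchy_cvg /(cvg_ex (T := V)) [l Fl]; exists l => e e0.
have : nbhs l [set y | rn (y - l) < e] by apply/nbhs_rn; exists e.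
by move=> /Fl [N _ HN]; exists N => n Nn; exact: HN.
Qed.

Lemma small_inv (e : R) : 0 < e ->
  exists N : nat, forall n, (N <= n)%N -> n.+1%:R^-1 < e.
Proof.
move=> e0; exists (Num.truncn e^-1) => n Nn.
rewrite invf_plt ?posrE //; apply: lt_le_trans (truncnS_gt _) _.
by rewrite ler_nat ltnS.
Qed.

End RealNorm.

(** * Indefinite forms and negative families *)

Section Form.
Variable R : realType.
Notation C := (Cplx R).

Lemma ker_ex (m n : nat) (M : 'M[C]_(n, m)) : (m < n)%N ->
  exists2 a : 'rV[C]_n, a != 0 & a *m M = 0.
Proof.
move=> mn; have : kermx M != 0.
  rewrite -mxrank_eq0 mxrank_ker subn_eq0 -ltnNge.
  exact: leq_ltn_trans (rank_leq_col M) mn.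
move=> /rowV0Pn[v vK v0]; exists v => //.
by apply/eqP; rewrite -sub_kermx.
Qed.

(** A crude Cauchy-Schwarz inequality: each [s i] is at most the square root of the sum of
    squares. *)
Lemma sqr_sum_le n (s t : 'I_n -> R) : (forall i, 0 <= s i) ->
  (forall i, 0 <= t i) ->
  (\sum_i s i * t i) ^+ 2 <= (\sum_i s i ^+ 2) * (\sum_i t i) ^+ 2.
Proof.
move=> s0 t0; set S := \sum_i s i ^+ 2.
have S0 : 0 <= S by apply: sumr_ge0 => i _; rewrite sqr_ge0.
rewrite -[X in X * _](sqr_sqrtr S0) -exprMn lerXn2r ?nnegrE //.
- by apply: sumr_ge0 => i _; rewrite mulr_ge0.
- by rewrite mulr_ge0 ?sqrtr_ge0 // sumr_ge0.
rewrite mulr_sumr; apply: ler_sum => i _; apply: ler_wpM2r => //.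
rewrite -[s i]ger0_norm // -sqrtr_sqr ler_wsqrtr // /S (bigD1 i) //= lerDl.
by apply: sumr_ge0 => j _; rewrite sqr_ge0.
Qed.

Section One.
Variable P : pontryagin R.
Implicit Types x y z : P.

Lemma fDl x y z : '[x + y, z] = '[x, z] + '[y, z].
Proof. exact: linearDl. Qed.
Lemma fDr x y z : '[x, y + z] = '[x, y] + '[x, z].
Proof. exact: linearDr. Qed.
Lemma fNl x z : '[- x, z] = - '[x, z].
Proof. exact: linearNl. Qed.
Lemma fNr x z : '[x, - z] = - '[x, z].
Proof. exact: linearNr. Qed.
Lemma fBl x y z : '[x - y, z] = '[x, z] - '[y, z].
Proof. by rewrite fDl fNl. Qed.
Lemma fBr x y z : '[x, y - z] = '[x, y] - '[x, z].
Proof. by rewrite fDr fNr. Qed.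
Lemma fZl (a : C) x y : '[a *: x, y] = a * '[x, y].
Proof. exact: linearZl_LR. Qed.
Lemma fZr (a : C) x y : '[x, a *: y] = a^* * '[x, y].
Proof. exact: linearZr_LR. Qed.
Lemma f0l y : '[0, y] = 0 :> C.
Proof. exact: linear0l. Qed.
Lemma f0r y : '[y, 0] = 0 :> C.
Proof. exact: linear0r. Qed.
Lemma fC x y : '[y, x]^* = '[x, y].
Proof. by rewrite [RHS]hermitian_subproof expr0 mul1r. Qed.
Lemma fsuml n (x : 'I_n -> P) y : '[\sum_i x i, y] = \sum_i '[x i, y].
Proof. exact: linear_sumlz. Qed.
Lemma fsumr n (x : 'I_n -> P) y : '[y, \sum_i x i] = \sum_i '[y, x i].
Proof. exact: linear_sumr. Qed.

Definition q x : R := re '[x, x].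

Lemma qE x : '[x, x] = rc (q x).
Proof. by apply: realE; rewrite CrealE fC. Qed.

Lemma q0 : q 0 = 0.
Proof. by rewrite /q f0l. Qed.

Lemma qN x : q (- x) = q x.
Proof. by rewrite /q fNl fNr opprK. Qed.

Lemma qD x y : q (x + y) = q x + q y + 2 * re '[x, y].
Proof. by rewrite /q fDl !fDr !reD -(fC y x) re_conj; ring. Qed.

Lemma qZ (a : C) x : q (a *: x) = rn a ^+ 2 * q x.
Proof. by apply: rcI; rewrite rcM -mul_conj -!qE fZl fZr mulrA. Qed.

Lemma fundamental_decomposition_real : exists (Vp Vm : set P) (c d : R),
  [/\ Defs.subspace Vp /\ Defs.subspace Vm,
      forall x, exists xp xm, [/\ Vp xp, Vm xm & x = xp + xm],
      (forall xp xm, Vp xp -> Vm xm -> '[xp, xm] = 0),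
      has_dim Vm (neg_index P)
    & [/\ 0 < c, 0 < d & forall xp xm, Vp xp -> Vm xm ->
        c * rn (xp + xm) ^+ 2 <= q xp - q xm <= d * rn (xp + xm) ^+ 2]].
Proof.
have [Vp [Vm [sV dV oV kV [c [d [c0 d0 H]]]]]] := pontryaginP P.
exists Vp, Vm, (re c), (re d); split=> //; split.
- by rewrite -lt_rc -ge0E // ltW.
- by rewrite -lt_rc -ge0E // ltW.
move=> xp xm Vxp Vxm; have [] := H xp xm Vxp Vxm.
rewrite !qE rnE -rcX (ge0E (ltW c0)) (ge0E (ltW d0)) -!rcM -rcN -rcD.
by rewrite !le_rc => -> ->.
Qed.

(** Since [q xp] is nonnegative and [q xm] nonpositive, the modulus of [q xp + q xm] is at most
    [q xp - q xm]. *)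
Lemma q_bounded : exists2 d : R, 0 < d & forall x, `|q x| <= d * rn x ^+ 2.
Proof.
have [Vp [Vm [c [d [[[p0 sp] [m0 sm]] dV oV _ [c0 d0 H]]]]]] :=
  fundamental_decomposition_real.
exists d => // x; have [xp [xm [pxp mxm ->]]] := dV x.
have /andP[_ h] := H _ _ pxp mxm.
rewrite qD oV // mulr0 addr0; apply: le_trans h.
have /andP[hp _] := H _ _ pxp m0; have /andP[hm _] := H _ _ p0 mxm.
move: hp hm; rewrite addr0 add0r q0 subr0 sub0r => hp hm.
have qp0 : 0 <= q xp by apply: le_trans hp; rewrite mulr_ge0 ?sqr_ge0 ?ltW.
have qm0 : 0 <= - q xm by apply: le_trans hm; rewrite mulr_ge0 ?sqr_ge0 ?ltW.
by rewrite ler_norml; apply/andP; split; lra.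
Qed.

(** By polarization, twice the real part of the form on unit vectors is at most 4 d + d + d in
    modulus. The imaginary part is handled by replacing x with i x, which gives 6 d. *)
Lemma form_bounded : exists2 m : R, 0 < m &
  forall x y, rn '[x, y] <= m * rn x * rn y.
Proof.
have [d d0 qd] := q_bounded.
have half x y : rn x <= 1 -> rn y <= 1 -> `|re '[x, y]| <= 3 * d.
  move=> x1 y1; have := qd (x + y); have := qd x; have := qd y.
  rewrite qD.
  have sx : rn x ^+ 2 <= 1 by rewrite expr_le1 ?rn_ge0.
  have sy : rn y ^+ 2 <= 1 by rewrite expr_le1 ?rn_ge0.
  have sxy : rn (x + y) ^+ 2 <= 4.
    have -> : 4 = 2 ^+ 2 :> R by rewrite -natrX.
    rewrite lerXn2r ?nnegrE ?rn_ge0 //.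
    by have := rnD x y; lra.
  rewrite !ler_norml => /andP[? ?] /andP[? ?] /andP[? ?].
  have := ler_wpM2l (ltW d0) sx; have := ler_wpM2l (ltW d0) sy.
  have := ler_wpM2l (ltW d0) sxy => ? ? ?.
  by apply/andP; split; lra.
exists (6 * d) => [|x y]; first by rewrite mulr_gt0.
have [->|x0] := eqVneq x 0; first by rewrite f0l !rn0 mulr0 mul0r.
have [->|y0] := eqVneq y 0; first by rewrite f0r !rn0 mulr0.
set a := rc (rn x)^-1; set b := rc (rn y)^-1.
have xp : 0 < rn x by rewrite rn_gt0.
have yp : 0 < rn y by rewrite rn_gt0.
have ra : rn a = (rn x)^-1 by rewrite rn_rc // invr_ge0 ltW.
have rb : rn b = (rn y)^-1 by rewrite rn_rc // invr_ge0 ltW.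
have xa : rn (a *: x) <= 1 by rewrite rnZ ra mulVf ?gt_eqF.
have xai : rn ('i *: (a *: x)) <= 1 by rewrite rnZ rn_i mul1r.
have yb : rn (b *: y) <= 1 by rewrite rnZ rb mulVf ?gt_eqF.
have : rn '[a *: x, b *: y] <= 6 * d.
  apply: le_trans (rn_le_re_im _) _.
  have := half _ _ xa yb; have := half _ _ xai yb.
  by rewrite [in X in X -> _]fZl [_ * 'i]mulrC; lra.
rewrite fZl fZr !rnM rn_conj ra rb => h.
have -> : rn '[x, y] = (rn x)^-1 * ((rn y)^-1 * rn '[x, y]) * (rn x * rn y).
  by field; rewrite !gt_eqF.
by rewrite -[leRHS]mulrA ler_wpM2r // mulr_ge0 ?rn_ge0.
Qed.

(** An orthonormal family for the opposite of the form. *)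
Definition negfam n (b : 'I_n -> P) :=
  forall i j, '[b i, b j] = - (i == j)%:R.

Lemma negfam_suml n (b : 'I_n -> P) (a : 'I_n -> C) j : negfam b ->
  '[\sum_i a i *: b i, b j] = - a j.
Proof.
move=> hb; rewrite fsuml (bigD1 j) //= big1 => [|i ij].
  by rewrite fZl hb eqxx mulrN1 addr0.
by rewrite fZl hb (negbTE ij) oppr0 mulr0.
Qed.

Lemma negfam_q n (b : 'I_n -> P) (a : 'I_n -> C) : negfam b ->
  q (\sum_i a i *: b i) = - \sum_i rn (a i) ^+ 2.
Proof.
move=> hb; apply: rcI; rewrite -qE fsumr rcN rc_sum -sumrN.
by apply: eq_bigr => i _; rewrite fZr negfam_suml // mulrN mulrC mul_conj.
Qed.

Lemma subspace_sumr (E : set P) n (a : 'I_n -> C) (v : 'I_n -> P) :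
  Defs.subspace E -> (forall i, E (v i)) -> E (\sum_i a i *: v i).
Proof.
move=> [E0 sE] Ev; elim: n a v Ev => [|n IH] a v Ev; first by rewrite big_ord0.
by rewrite big_ord_recr /= addrC; apply: sE; [exact: Ev|exact: IH].
Qed.

(* The rows of [M] are the coordinates of the negative parts of the [b i] in a
   fundamental decomposition, so a combination killed by [M] is positive. *)
Lemma negative_coordinates n (b : 'I_n -> P) :
  exists (c : R) (M : 'M[C]_(n, neg_index P)), [/\ 0 < c,
    forall a : 'rV_n, a *m M = 0 ->
      c * rn (\sum_i a 0 i *: b i) ^+ 2 <= q (\sum_i a 0 i *: b i) &
    forall x, exists xi : 'rV_(neg_index P), forall a : 'rV_n, a *m M = xi ->
      c * rn (x - \sum_i a 0 i *: b i) ^+ 2 <= q (x - \sum_i a 0 i *: b i)].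
Proof.
have [Vp [Vm [c [d [[[p0 sp] [m0 sm]] dV oV [e [efree eV]] [c0 d0 H]]]]]] :=
  fundamental_decomposition_real.
have Vp_q x : Vp x -> c * rn x ^+ 2 <= q x.
  by move=> px; have /andP[] := H _ _ px m0; rewrite addr0 q0 subr0.
have /choice[bp hp] : forall i, exists xp, Vp xp /\
    exists M : 'I_(neg_index P) -> C, b i = xp + \sum_j M j *: e j.
  move=> i; have [xp [xm [pxp /eV[M ->] ->]]] := dV (b i).
  by exists xp; split=> //; exists M.
have /choice[M hM] : forall i, exists M : 'I_(neg_index P) -> C,
  b i = bp i + \sum_j M j *: e j by move=> i; have [] := hp i.
have pV a : Vp (\sum_i a i *: bp i).
  by apply: subspace_sumr => // i; have [] := hp i.
pose N := \matrix_(i, j) M i j.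
have sumE (a : 'rV[C]_n) : \sum_i a 0 i *: b i =
    \sum_i a 0 i *: bp i + \sum_j (a *m N) 0 j *: e j.
  under eq_bigr do rewrite hM scalerDr.
  rewrite big_split /=; congr (_ + _).
  under eq_bigr do rewrite scaler_sumr.
  rewrite exchange_big /=; apply: eq_bigr => j _.
  under eq_bigr do rewrite scalerA.
  rewrite -scaler_suml mxE; congr (_ *: _).
  by apply: eq_bigr => i _; rewrite mxE.
exists c, N; split=> // [a aN|x].
  apply: Vp_q; rewrite sumE aN [X in _ + X]big1 ?addr0 // => j _.
  by rewrite mxE scale0r.
have [xp [xm [pxp /eV[xi ->] ->]]] := dV x.
exists (\row_j xi j) => a aN; apply: Vp_q.
rewrite sumE aN opprD addrACA [X in _ + X](_ : _ = 0) ?addr0.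
  by rewrite addrC -scaleN1r; apply: sp.
apply/eqP; rewrite subr_eq0; apply/eqP; apply: eq_bigr => j _.
by rewrite mxE.
Qed.

Lemma negfam_free n (b : 'I_n -> P) (a : 'rV[C]_n) (c : R) : negfam b -> 0 < c ->
  c * rn (\sum_i a 0 i *: b i) ^+ 2 <= q (\sum_i a 0 i *: b i) -> a = 0.
Proof.
move=> hb c0; rewrite negfam_q // => h.
have s0 : \sum_i rn (a 0 i) ^+ 2 <= 0.
  rewrite -oppr_ge0; apply: le_trans h.
  by rewrite mulr_ge0 ?sqr_ge0 ?ltW.
apply/rowP => i; rewrite mxE.
apply/eqP; rewrite -rn_eq0 -sqrf_eq0 eq_le sqr_ge0 andbT; apply: le_trans s0.
by rewrite (bigD1 i) //= lerDl; apply: sumr_ge0 => j _; rewrite sqr_ge0.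
Qed.

(** Among more than [neg_index P] vectors some nonzero combination has no negative part in a
    fundamental decomposition, whereas [negfam_q] makes its form negative. *)
Lemma negfam_le n (b : 'I_n -> P) : negfam b -> (n <= neg_index P)%N.
Proof.
move=> hb; rewrite leqNgt; apply/negP => kn.
have [c [M [c0 pM _]]] := negative_coordinates b.
have [a a0 aM] := ker_ex M kn.
by move/eqP: a0; apply; apply: negfam_free hb c0 (pM a aM).
Qed.

(** The component of x in the span of b contributes minus the sum to [q x], and the factor 2 flips
    its sign. For a negative family of maximal size this is the square of the Hilbert norm given by
    the fundamental decomposition with negative part span b. *)
Definition nb n (b : 'I_n -> P) x : R := q x + 2 * \sum_i rn '[x, b i] ^+ 2.

(** The component orthogonal to b; the sign is a plus because the [b i] have square -1. *)
Definition negproj n (b : 'I_n -> P) x : P := x + \sum_i '[x, b i] *: b i.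

Lemma negproj_orth n (b : 'I_n -> P) x j : negfam b -> '[negproj b x, b j] = 0.
Proof. by move=> hb; rewrite fDl negfam_suml // subrr. Qed.

Lemma negproj_q n (b : 'I_n -> P) x : negfam b ->
  q (negproj b x) = q x + \sum_i rn '[x, b i] ^+ 2.
Proof.
move=> hb; rewrite qD negfam_q // fsumr.
suff -> : \sum_i '[x, '[x, b i] *: b i] = rc (\sum_i rn '[x, b i] ^+ 2).
  by rewrite rcK; ring.
by rewrite rc_sum; apply: eq_bigr => i _; rewrite fZr mulrC mul_conj.
Qed.

(** The coordinate matrix [M] is square and has independent rows, so some combination of the [b i]
    has the same negative part as x, and the difference y satisfies [c * rn y ^+ 2 <= q y]. As x is
    orthogonal to b, [q x] is [q y] plus the sum of the squared coefficients, and so controls both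
    pieces of x. *)
Lemma negfam_posdef (b : 'I_(neg_index P) -> P) : negfam b ->
  exists2 K : R, 0 < K &
    forall x, (forall i, '[x, b i] = 0) -> rn x ^+ 2 <= K * q x.
Proof.
move=> hb; have [c [M [c0 pM solM]]] := negative_coordinates b.
have freeM : row_free M.
  rewrite -kermx_eq0; apply/negPn/negP => /rowV0Pn[a /sub_kermxP aM /eqP].
  by apply; apply: negfam_free hb c0 (pM a aM).
have solve x : exists a : 'I_(neg_index P) -> C,
    c * rn (x - \sum_i a i *: b i) ^+ 2 <= q (x - \sum_i a i *: b i).
  have [xi hxi] := solM x; exists ((xi *m invmx M) 0); apply: hxi.
  by rewrite -mulmxA mulVmx ?mulmx1 // -row_free_unit.
set T := \sum_i rn (b i).
have T0 : 0 <= T by apply: sumr_ge0 => i _; rewrite rn_ge0.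
exists (2 * (c^-1 + T ^+ 2)) => [|x xb].
  by rewrite mulr_gt0 // ltr_pwDl ?invr_gt0 // sqr_ge0.
have [a pa] := solve x; set y := x - _ in pa.
set S := \sum_i rn (a i) ^+ 2.
have qy : q y = q x - S.
  rewrite /y qD qN negfam_q // -/S fNr fsumr big1 ?oppr0 ?mulr0 ?addr0 // => i _.
  by rewrite fZr xb mulr0.
have S0 : 0 <= S by apply: sumr_ge0 => i _; rewrite sqr_ge0.
have hy : rn y ^+ 2 <= c^-1 * q y.
  by rewrite mulrC ler_pdivlMr // mulrC.
have qy0 : 0 <= q y.
  by apply: le_trans pa; rewrite mulr_ge0 ?sqr_ge0 ?ltW.
have xE : x = y + \sum_i a i *: b i by rewrite /y subrK.
have hx : rn x <= rn y + \sum_i rn (a i) * rn (b i).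
  rewrite {1}xE; apply: le_trans (rnD _ _) _; rewrite lerD2l.
  apply: le_trans (rn_sum _) _.
  by apply: ler_sum => i _; rewrite rnZ.
have hs : (\sum_i rn (a i) * rn (b i)) ^+ 2 <= S * T ^+ 2.
  by apply: sqr_sum_le => i; exact: rn_ge0.
set s := \sum_i rn (a i) * rn (b i) in hx hs.
have s0 : 0 <= s by apply: sumr_ge0 => i _; rewrite mulr_ge0 ?rn_ge0.
have h1 : rn x ^+ 2 <= 2 * rn y ^+ 2 + 2 * s ^+ 2.
  have : rn x ^+ 2 <= (rn y + s) ^+ 2.
    by rewrite lerXn2r ?nnegrE ?addr_ge0 ?rn_ge0.
  by have := sqr_ge0 (rn y - s); nra.
have ci : 0 < c^-1 by rewrite invr_gt0.
have e1 : c^-1 * q y <= c^-1 * q x by rewrite ler_pM2l // qy; lra.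
have e2 : S * T ^+ 2 <= T ^+ 2 * q x.
  by rewrite mulrC ler_wpM2l ?sqr_ge0 //; lra.
by lra.
Qed.

(** [negfam_posdef] controls [negproj b x], and the coefficients removed from x appear in [nb]. *)
Lemma negfam_equiv (b : 'I_(neg_index P) -> P) : negfam b ->
  exists2 K : R, 0 < K & forall x, rn x ^+ 2 <= K * nb b x.
Proof.
move=> hb; have [K K0 HK] := negfam_posdef hb.
set T := \sum_i rn (b i).
have T0 : 0 <= T by apply: sumr_ge0 => i _; rewrite rn_ge0.
exists (2 * (K + T ^+ 2)) => [|x].
  by rewrite mulr_gt0 // ltr_pwDl // sqr_ge0.
set y := negproj b x; set S := \sum_i rn '[x, b i] ^+ 2.
have hy : rn y ^+ 2 <= K * q y by apply: HK => i; exact: negproj_orth.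
have qy : q y = q x + S by exact: negproj_q.
have S0 : 0 <= S by apply: sumr_ge0 => i _; rewrite sqr_ge0.
have xE : x = y - \sum_i '[x, b i] *: b i by rewrite /y addrK.
have hx : rn x <= rn y + \sum_i rn '[x, b i] * rn (b i).
  rewrite {1}xE; apply: le_trans (rnB _ _) _; rewrite lerD2l.
  apply: le_trans (rn_sum _) _.
  by apply: ler_sum => i _; rewrite rnZ.
have hs : (\sum_i rn '[x, b i] * rn (b i)) ^+ 2 <= S * T ^+ 2.
  by apply: sqr_sum_le => i; exact: rn_ge0.
set s := \sum_i _ * rn (b i) in hx hs.
have s0 : 0 <= s by apply: sumr_ge0 => i _; rewrite mulr_ge0 ?rn_ge0.
have h1 : rn x ^+ 2 <= 2 * rn y ^+ 2 + 2 * s ^+ 2.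
  have : rn x ^+ 2 <= (rn y + s) ^+ 2.
    by rewrite lerXn2r ?nnegrE ?addr_ge0 ?rn_ge0.
  by have := sqr_ge0 (rn y - s); nra.
have qy0 : 0 <= q y.
  by rewrite -(pmulr_rge0 _ K0); apply: le_trans hy; rewrite sqr_ge0.
rewrite /nb -/S.
have e1 : K * q y <= K * (q x + 2 * S) by rewrite ler_pM2l // qy; lra.
have e2 : S * T ^+ 2 <= T ^+ 2 * (q x + 2 * S).
  by rewrite mulrC ler_wpM2l ?sqr_ge0 //; lra.
by lra.
Qed.

End One.
End Form.

(** * Maximal negative families inside dense subspaces *)

Section Density.
Variable R : realType.
Notation C := (Cplx R).

Section One.
Variable P : pontryagin R.
Implicit Types x y z : P.

Definition near_dense (D : set P) :=
  forall x (e : R), 0 < e -> exists2 y, D y & rn (y - x) < e.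

Lemma near_denseT : near_dense setT.
Proof. by move=> x e e0; exists x; rewrite // subrr rn0. Qed.

Lemma q_lt0_open x : q x < 0 ->
  exists2 e : R, 0 < e & forall y, rn (y - x) < e -> q y < 0.
Proof.
move=> qx0; have [d d0 qd] := q_bounded P.
have [m m0 fm] := form_bounded P.
(* For [rn w < 1], [q (x + w)] exceeds [q x] by at most [L * rn w]. *)
set L := d + 2 * (m * rn x).
have L0 : 0 < L by rewrite ltr_wpDr // !mulr_ge0 ?rn_ge0 // ltW.
exists (Num.min 1 (- q x / L)).
  by rewrite lt_min ltr01 divr_gt0 // oppr_gt0.
move=> y; rewrite lt_min ltr_pdivlMr // => /andP[w1 w2].
rewrite -[y](subrK x) addrC; set w := y - x in w1 w2 *.
rewrite qD; have := qd w; rewrite ler_norml => /andP[_ hq].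
have hf := le_trans (re_le _) (fm x w).
have w0 := rn_ge0 w.
have : d * rn w ^+ 2 <= d * rn w.
  by rewrite ler_pM2l // expr2 ler_piMl // ltW.
rewrite /L in w2; nra.
Qed.

(** By dimension count the negative part of a fundamental decomposition contains a nonzero [v]
    orthogonal to b. A vector of [D] close to [v], made orthogonal to b by [negproj], stays in [D]
    because the [b i] do, and stays negative because negativity is an open condition; it only
    remains to normalize it. *)
Lemma negfam_extend n (b : 'I_n -> P) (D : set P) :
  Defs.subspace D -> near_dense D -> (n < neg_index P)%N ->
  negfam b -> (forall i, D (b i)) ->
  exists2 b' : 'I_n.+1 -> P, negfam b' & forall i, D (b' i).
Proof.
move=> [D0 sD] dD nk hb bD.
have [Vp [Vm [c [d [[[p0 sp] [m0 sm]] _ _ [e [efree eV]] [c0 d0 H]]]]]] :=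
  fundamental_decomposition_real P.
have [a a0 aM] := ker_ex (\matrix_(j, i) '[e j, b i]) nk.
set v := \sum_j a 0 j *: e j.
have vb i : '[v, b i] = 0.
  have := congr1 (fun A : 'rV_ _ => A 0 i) aM; rewrite mxE [RHS]mxE => <-.
  by rewrite fsuml; apply: eq_bigr => j _; rewrite fZl mxE.
have v0 : v != 0.
  apply: contra a0 => /eqP /efree a0; apply/eqP/rowP => j.
  by rewrite a0 mxE.
have qv : q v < 0.
  have Vv : Vm v by apply/eV; exists (a 0).
  have /andP[+ _] := H _ _ p0 Vv; rewrite add0r q0 sub0r => h.
  rewrite -oppr_gt0; apply: lt_le_trans h.
  by rewrite mulr_gt0 // exprn_gt0 // rn_gt0.
have [r r0 Hr] := q_lt0_open qv.
have [m mp fm] := form_bounded P.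
(* A Lipschitz constant of [negproj b], which fixes [v]. *)
set L := 1 + \sum_i m * rn (b i) * rn (b i).
have L0 : 0 < L.
  by rewrite ltr_pwDl // sumr_ge0 // => i _; rewrite !mulr_ge0 ?rn_ge0 // ltW.
have [y Dy hy] := dD v (r / L) (divr_gt0 r0 L0).
have qx : q (negproj b y) < 0.
  apply: Hr; have -> : negproj b y - v = negproj b (y - v).
    rewrite /negproj addrAC; congr (_ + _).
    by apply: eq_bigr => i _; rewrite fBl vb subr0.
  move: hy; rewrite ltr_pdivlMr //; apply: le_lt_trans.
  apply: le_trans (rnD _ _) _; rewrite /L mulrDr mulr1 lerD2l mulr_sumr.
  apply: le_trans (rn_sum _) _; apply: ler_sum => i _; rewrite rnZ.
  by rewrite mulrA ler_wpM2r ?rn_ge0 // mulrCA mulrA.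
set x := negproj b y in qx.
have Dx : D x.
  rewrite /x /negproj addrC -[y]scale1r -/(negproj b y).
  have : Defs.subspace D by [].
  move=> sD'; have h : D (\sum_i '[y, b i] *: b i) by exact: subspace_sumr.
  by rewrite scale1r -[X in X + _]scale1r; apply: sD.
have xb i : '[x, b i] = 0 by exact: negproj_orth.
set t := Num.sqrt (- q x).
have t0 : 0 < t by rewrite sqrtr_gt0 oppr_gt0.
pose bn := rc t^-1 *: x.
have bnbn : '[bn, bn] = -1.
  rewrite qE qZ rn_rc ?invr_ge0 ?ltW // exprVn sqr_sqrtr ?oppr_ge0 ?ltW //.
  rewrite (_ : _ * _ = -1) ?rcN //.
  by field; rewrite lt_eqF.
have bnb i : '[bn, b i] = 0 by rewrite fZl xb mulr0.
exists (fun i => if unlift ord0 i is Some j then b j else bn).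
  move=> i j; case: (unliftP ord0 i) => [i' ->|->];
    case: (unliftP ord0 j) => [j' ->|->].
  - by rewrite hb (inj_eq lift_inj).
  - by rewrite -fC bnb conjC0 eq_sym (negbTE (neq_lift _ _)) oppr0.
  - by rewrite bnb (negbTE (neq_lift _ _)) oppr0.
  - by rewrite bnbn eqxx.
move=> i; case: (unlift ord0 i) => [j|] //.
by rewrite -[bn]addr0; apply: sD.
Qed.

Lemma negfam_dense (D : set P) : Defs.subspace D -> near_dense D ->
  exists2 b : 'I_(neg_index P) -> P, negfam b & forall i, D (b i).
Proof.
move=> sD dD.
suff H n : (n <= neg_index P)%N ->
    exists2 b : 'I_n -> P, negfam b & forall i, D (b i) by exact: H.
elim: n => [_|n IH nk]; first by exists (fun=> 0) => [[]|[]].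
have [b hb bD] := IH (ltnW nk).
exact: negfam_extend dD nk hb bD.
Qed.

Section Projection.
Variable b : 'I_(neg_index P) -> P.

(** For a negative family this is the form of x with J y, where J is the symmetry sending each [b i]
    to its opposite and fixing the orthogonal complement of b; [nb] is its quadratic form. *)
Definition hform x y : C := '[x, y + \sum_i (2 * '[y, b i]) *: b i].

Lemma hform_nb x : re (hform x x) = nb b x.
Proof.
rewrite /hform fDr reD; congr (_ + _).
rewrite fsumr -[RHS]rcK; congr re; rewrite rcM rc_sum mulr_sumr.
apply: eq_bigr => i _; rewrite fZr conjM conjC_nat.
by rewrite -mul_conj rc_nat; ring.
Qed.

Lemma hformDl x y z : hform (x + y) z = hform x z + hform y z.
Proof. exact: fDl. Qed.

Lemma hformZl a x z : hform (a *: x) z = a * hform x z.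
Proof. exact: fZl. Qed.

Lemma hformE x y : hform x y = '[x, y] + 2 * \sum_i '[x, b i] * '[b i, y].
Proof.
rewrite /hform fDr fsumr; congr (_ + _); rewrite mulr_sumr.
by apply: eq_bigr => i _; rewrite fZr conjM conjC_nat fC; ring.
Qed.

Lemma hformC x y : (hform y x)^* = hform x y.
Proof.
rewrite !hformE conjD conjM conjC_nat conj_sum fC; congr (_ + _ * _).
by apply: eq_bigr => i _; rewrite conjM !fC mulrC.
Qed.

Lemma nbD x y : nb b (x + y) = nb b x + nb b y + 2 * re (hform x y).
Proof.
rewrite -!hform_nb.
have D y' : re (hform y' (x + y)) = re (hform x y') + re (hform y y').
  by rewrite -(hformC y') re_conj hformDl reD.
rewrite hformDl reD !D.
have -> : re (hform y x) = re (hform x y) by rewrite -(hformC y) re_conj.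
by ring.
Qed.

End Projection.

End One.
End Density.

(** * Orthogonal projection *)

Section Projection.
Variable R : realType.
Notation C := (Cplx R).

Section One.
Variables (P : pontryagin R) (b : 'I_(neg_index P) -> P) (hb : negfam b).
Implicit Types x y z : P.

Lemma hformNl x z : hform b (- x) z = - hform b x z.
Proof. exact: fNl. Qed.

Lemma nbZ (a : C) x : nb b (a *: x) = rn a ^+ 2 * nb b x.
Proof.
rewrite /nb qZ mulrDr; congr (_ + _).
rewrite [RHS]mulrCA; congr (2 * _); rewrite mulr_sumr.
by apply: eq_bigr => i _; rewrite fZl rnM exprMn.
Qed.

Lemma nbN x : nb b (- x) = nb b x.
Proof. by rewrite -scaleN1r nbZ rnN rn1 expr1n mul1r. Qed.

Lemma nb_ge0 x : 0 <= nb b x.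
Proof.
have [K K0 HK] := negfam_equiv hb.
by rewrite -(pmulr_rge0 _ K0); apply: le_trans (HK x); rewrite sqr_ge0.
Qed.

Lemma nb_bounded : exists2 K : R, 0 < K & forall x, nb b x <= K * rn x ^+ 2.
Proof.
have [d d0 qd] := q_bounded P; have [m m0 fm] := form_bounded P.
set S := \sum_i (m * rn (b i)) ^+ 2.
have S0 : 0 <= S by apply: sumr_ge0 => i _; rewrite sqr_ge0.
exists (d + 2 * S) => [|x]; first by rewrite ltr_wpDr // mulr_ge0.
rewrite mulrDl lerD //; first by apply: le_trans (qd x); rewrite ler_norm.
rewrite -mulrA ler_pM2l // mulr_suml; apply: ler_sum => i _.
have m0' := ltW m0.
by rewrite -exprMn lerXn2r ?nnegrE ?mulr_ge0 ?rn_ge0 // mulrAC fm.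
Qed.

Lemma hform_bounded : exists2 K : R, 0 < K &
  forall x y, rn (hform b x y) <= K * rn x * rn y.
Proof.
have [m m0 fm] := form_bounded P.
set S := \sum_i rn (b i) * rn (b i).
have S0 : 0 <= S by apply: sumr_ge0 => i _; rewrite mulr_ge0 ?rn_ge0.
exists (m * (1 + 2 * m * S)) => [|x y].
  by rewrite mulr_gt0 // ltr_pwDl // !mulr_ge0 // ltW.
apply: le_trans (fm _ _) _.
rewrite [leRHS](_ : _ = m * rn x * ((1 + 2 * m * S) * rn y)); last by ring.
rewrite ler_wpM2l ?mulr_ge0 ?rn_ge0 ?(ltW m0) //.
apply: le_trans (rnD _ _) _; rewrite mulrDl mul1r lerD2l.
apply: le_trans (rn_sum _) _.
rewrite [leRHS](_ : _ = 2 * m * rn y * S); last by ring.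
rewrite /S mulr_sumr; apply: ler_sum => i _.
rewrite rnZ rnM -rc_nat rn_rc //.
rewrite [leRHS](_ : _ = 2 * (m * rn y * rn (b i)) * rn (b i)); last by ring.
by rewrite ler_wpM2r ?rn_ge0 // ler_pM2l.
Qed.

Lemma nb_parallelogram x y :
  nb b (x + y) + nb b (x - y) = 2 * nb b x + 2 * nb b y.
Proof.
have -> : nb b (x - y) = nb b x + nb b y - 2 * re (hform b x y).
  rewrite nbD nbN -(hformC b x) re_conj hformNl reN mulrN.
  by rewrite -(hformC b y) re_conj.
by rewrite nbD; ring.
Qed.

(* Orthogonality is for the positive definite form [hform b], whose norm is
   equivalent to that of P. *)
Lemma projection (E : set P) x : Defs.subspace E ->
  exists l v, [/\ x = l + v,
    forall e : R, 0 < e -> exists2 y, E y & rn (y - l) < e &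
    forall y, E y -> hform b y v = 0].
Proof.
move=> [E0 sE].
have [K K0 HK] := negfam_equiv hb.
pose A : set R := [set nb b (x - e) | e in E].
have A0 : A !=set0 by exists (nb b (x - 0)), 0.
have Alb : lbound A 0 by move=> _ [e _ <-]; exact: nb_ge0.
have hA : has_inf A by split=> //; exists 0.
set d := inf A.
have dle e : E e -> d <= nb b (x - e).
  by move=> Ee; apply: ge_inf; [exists 0|exists e].
have /choice[u hu] : forall n : nat, exists e, E e /\ nb b (x - e) < d + n.+1%:R^-1.
  move=> n; have n0 : 0 < n.+1%:R^-1 :> R by rewrite invr_gt0.
  by have [_ [e Ee <-] he] := inf_adherent n0 hA; exists e.
have Eu n : E (u n) by have [] := hu n.
have du n : nb b (x - u n) < d + n.+1%:R^-1 by have [] := hu n.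
(* Parallelogram law: the midpoint of [u n] and [u m] is in [E], so its distance to x is bounded
   below by [d]. *)
have cauchy n m : rn (u n - u m) ^+ 2 <= K * (2 * n.+1%:R^-1 + 2 * m.+1%:R^-1).
  apply: le_trans (HK _) _; rewrite ler_pM2l //.
  have := nb_parallelogram (x - u m) (x - u n).
  have -> : x - u m - (x - u n) = u n - u m by rewrite opprB addrC addrA subrK.
  pose e := rc 2^-1 *: (u m + u n).
  have Ee : E e.
    rewrite /e scalerDr; apply: (sE) => //.
    by rewrite -[_ *: _]addr0; apply: sE.
  have -> : x - u m + (x - u n) = rc 2 *: (x - e).
    rewrite /e scalerBr scalerA -rcM divff ?pnatr_eq0 // rc1 scale1r.
    rewrite -[rc 2]/(rc (1 + 1)) rcD.
    by rewrite scalerDl !scale1r opprD addrACA.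
  rewrite nbZ rn_rc //; have := dle _ Ee; have := du n; have := du m.
  by move: (nb b _) (nb b _) (nb b _) (nb b _) n.+1%:R^-1 m.+1%:R^-1 => *; lra.
have [l ul] : exists l, lim_seq u l.
  apply: lim_seq_cauchy => e e0.
  have h0 : 0 < e ^+ 2 / (4 * K) by rewrite divr_gt0 ?exprn_gt0 // mulr_gt0.
  have [N HN] := small_inv h0; exists N => n m Nn Nm.
  have := cauchy n m; have := HN n Nn; have := HN m Nm.
  rewrite !ltr_pdivlMr ?mulr_gt0 // => h1 h2 h3.
  rewrite -(@ltr_pXn2r _ 2) ?nnegrE ?rn_ge0 ?ltW //.
  apply: le_lt_trans h3 _; move: h1 h2.
  by move: n.+1%:R^-1 m.+1%:R^-1 => a c; lra.
exists l, (x - l); split; first by rewrite addrC subrK.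
  by move=> e e0; have [N HN] := ul e e0; exists (u N) => //; exact: HN.
move=> f Ef; apply/eqP; rewrite -rn_eq0 eq_le rn_ge0 andbT.
apply/ler_addgt0Pl => e e0; rewrite addr0.
(* Moving from [u n] by F^-1 c^* in the direction f, with c the product of f and [x - u n], lowers
   [nb] by at least F^-1 |c|^2. As [u n] is almost minimizing, |c|^2 is at most F / (n + 1). The
   summand 1 keeps F nonzero. *)
set F := nb b f + 1.
have F0 : 0 < F by rewrite ltr_wpDl // nb_ge0.
have hn n : rn (hform b f (x - u n)) ^+ 2 <= F * n.+1%:R^-1.
  set c := hform b f (x - u n).
  have Ef' : E (u n + (rc F^-1 * c^*) *: f) by rewrite addrC; apply: sE.
  have := dle _ Ef'; rewrite opprD addrA -scaleNr nbD nbZ rnN rnM rn_conj.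
  rewrite rn_rc ?invr_ge0 ?(ltW F0) // -hformC re_conj hformZl -/c mulNr reN.
  rewrite [rc _ * _ * _]mulrAC -mulrA mul_conj -rcM rcK exprMn.
  have := du n; set s := rn c ^+ 2; set k := n.+1%:R^-1; set v := nb b (x - u n).
  move=> hv h.
  have Fs : F^-1 ^+ 2 * s * nb b f <= F^-1 * s.
    rewrite expr2 mulrAC ler_wpM2r ?sqr_ge0 // -mulrA ler_piMr ?invr_ge0 ?ltW //.
    by rewrite mulrC ltr_pdivrMr // mul1r /F ltrDl.
  have : F^-1 * s <= k by lra.
  by rewrite mulrC ler_pdivrMr // mulrC.
have [M M0 hM] := hform_bounded.
have e2 : 0 < (e / 2) ^+ 2 / F by rewrite divr_gt0 ?exprn_gt0 ?divr_gt0.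
have [N HN] := small_inv e2.
have L0 : 0 < e / 2 / (M * (rn f + 1)).
  by rewrite !divr_gt0 // mulr_gt0 // ltr_wpDl ?rn_ge0.
have [N' HN'] := ul _ L0.
set n := maxn N N'.
have := hn n; have := HN n (leq_maxl _ _); have := HN' n (leq_maxr _ _) => h1 h2 h3.
have -> : x - l = (x - u n) + (u n - l) by rewrite addrA subrK.
rewrite -hformC hformDl conjD !hformC; apply: le_trans (rnD _ _) _.
have h4 : rn (hform b f (x - u n)) <= e / 2.
  have e20 : 0 <= e / 2 by rewrite divr_ge0 // ltW.
  rewrite -(@ler_pXn2r _ 2) ?nnegrE ?rn_ge0 //.
  apply: le_trans h3 _; rewrite mulrC -ler_pdivlMr //; exact: ltW.
have h5 : rn (hform b f (u n - l)) <= e / 2.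
  apply: le_trans (hM _ _) _.
  move: h1; rewrite ltr_pdivlMr ?mulr_gt0 ?ltr_wpDl ?rn_ge0 // => /ltW h.
  apply: le_trans h; rewrite [leRHS]mulrC mulrDr mulr1 mulrDl lerDl.
  by rewrite mulr_ge0 ?rn_ge0 // ltW.
by lra.
Qed.

End One.

(** The part [v] of x that is [hform b]-orthogonal to [E] satisfies ['[y, J v] = 0] on [E], J being
    the symmetry in [hform]. The hypothesis kills J v, hence [nb b v] and then [v]. *)
Lemma total_dense (P : pontryagin R) (E : set P) : Defs.subspace E ->
  (forall x, (forall y, E y -> '[y, x] = 0) -> x = 0) -> near_dense E.
Proof.
move=> sE tE x e e0.
have sT : Defs.subspace [set: P] by [].
have [b hb _] := negfam_dense sT (@near_denseT _ P).
have [l [v [-> cl ov]]] := projection hb x sE.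
have v0 : v = 0.
  have /tE w0 : forall y, E y -> '[y, v + \sum_i (2 * '[v, b i]) *: b i] = 0.
    by move=> y Ey; rewrite -[LHS]/(hform b y v) ov.
  have : nb b v = 0 by rewrite -hform_nb /hform w0 f0r.
  have [K K0 HK] := negfam_equiv hb => n0.
  apply/eqP; rewrite -rn_eq0 -sqrf_eq0 eq_le sqr_ge0 andbT.
  by apply: le_trans (HK v) _; rewrite n0 mulr0.
have [y Ey hy] := cl e e0; exists y => //.
by rewrite v0 addr0.
Qed.

Lemma near_dense_total (P : pontryagin R) (E : set P) x : near_dense E ->
  (forall y, E y -> '[x, y] = 0) -> forall y, '[x, y] = 0.
Proof.
move=> dE xE y; have [m m0 fm] := form_bounded P.
apply/eqP; rewrite -rn_eq0 eq_le rn_ge0 andbT.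
apply/ler_addgt0Pl => e e0; rewrite addr0.
have M0 : 0 < m * rn x + 1 by rewrite ltr_wpDl // mulr_ge0 ?rn_ge0 ?ltW.
have [z Ez hz] := dE y (e / (m * rn x + 1)) (divr_gt0 e0 M0).
have -> : '[x, y] = '[x, y - z] by rewrite fBr (xE z Ez) subr0.
apply: le_trans (fm _ _) _; rewrite rnBC.
move: hz; rewrite ltr_pdivlMr // mulrC => /ltW h; apply: le_trans h.
by rewrite ler_wpM2r ?rn_ge0 // lerDl.
Qed.

(** [nb b x] is computed from products of x alone, all of which vanish. *)
Lemma nondeg (P : pontryagin R) (x : P) : (forall y, '[x, y] = 0) -> x = 0.
Proof.
move=> x0; have sT : Defs.subspace [set: P] by [].
have [b hb _] := negfam_dense sT (@near_denseT _ P).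
have [K K0 HK] := negfam_equiv hb.
apply/eqP; rewrite -rn_eq0 -sqrf_eq0 eq_le sqr_ge0 andbT.
apply: le_trans (HK x) _; rewrite /nb /q x0 big1 ?mulr0 ?addr0 ?mulr0 // => i _.
by rewrite x0 rn0 expr0n.
Qed.

Lemma form_inj (P : pontryagin R) (x x' : P) :
  (forall y, '[x, y] = '[x', y]) -> x = x'.
Proof.
move=> h; apply/eqP; rewrite -subr_eq0; apply/eqP; apply: nondeg => y.
by rewrite fBl h subrr.
Qed.

End Projection.

(** * Bounded operators and adjoints *)

Section Operators.
Variable R : realType.
Notation C := (Cplx R).

Section Lin.
Variables (V W : lmodType C) (T : V -> W).
Hypothesis lT : linear T.

Lemma linD x y : T (x + y) = T x + T y.
Proof. by have := lT 1 x y; rewrite !scale1r. Qed.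

Lemma lin0 : T 0 = 0.
Proof. by have /eqP := linD 0 0; rewrite addr0 -subr_eq subrr eq_sym => /eqP. Qed.

Lemma linZ a x : T (a *: x) = a *: T x.
Proof. by have := lT a x 0; rewrite !addr0 lin0 addr0. Qed.

Lemma linN x : T (- x) = - T x.
Proof. by rewrite -scaleN1r linZ scaleN1r. Qed.

Lemma linB x y : T (x - y) = T x - T y.
Proof. by rewrite linD linN. Qed.

Lemma lin_sum n (a : 'I_n -> C) (v : 'I_n -> V) :
  T (\sum_i a i *: v i) = \sum_i a i *: T (v i).
Proof.
elim: n a v => [|n IH] a v; first by rewrite !big_ord0 lin0.
by rewrite !big_ord_recr /= linD linZ IH.
Qed.

End Lin.

Lemma bop_bounded (V W : normedModType C) (T : V -> W) : bop T ->
  exists2 M : R, 0 < M & forall x, rn (T x) <= M * rn x.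
Proof.
move=> [lT cT].
have : nbhs (T 0) [set y | rn (y - T 0) < 1].
  by apply/nbhs_rn; exists 1.
move=> /(cT 0) /nbhs_rn[e e0 He].
exists (2 / e) => [|x]; first by rewrite divr_gt0.
have [->|x0] := eqVneq x 0; first by rewrite (lin0 lT) !rn0 mulr0.
have xp : 0 < rn x by rewrite rn_gt0.
set a := e / 2 / rn x.
have a0 : 0 < a by rewrite !divr_gt0.
have : rn (rc a *: x - 0) < e.
  by rewrite subr0 rnZ rn_rc ?ltW // /a divfK ?gt_eqF //; lra.
move=> /He /=; rewrite (lin0 lT) subr0 (linZ lT) rnZ rn_rc ?(ltW a0) // => h.
rewrite -(ler_pM2l a0); apply: le_trans (ltW h) _.
rewrite [leRHS](_ : _ = 1) // /a; field.
by rewrite !gt_eqF.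
Qed.

Lemma bopP (V W : normedModType C) (T : V -> W) (M : R) : linear T ->
  (forall x, rn (T x) <= M * rn x) -> bop T.
Proof.
move=> lT bT; split=> // x B /nbhs_rn[e e0 eB]; apply/nbhs_rn.
have M0 : 0 < `|M| + 1 by rewrite ltr_wpDl.
exists (e / (`|M| + 1)); first by rewrite divr_gt0.
move=> y; rewrite ltr_pdivlMr // => hy; apply: eB; rewrite -(linB lT).
apply: le_lt_trans (bT _) _; apply: le_lt_trans hy; rewrite mulrC.
by rewrite ler_wpM2l ?rn_ge0 // (le_trans (ler_norm M)) // lerDl.
Qed.

Lemma rn_q (U : hilbert R) (x : U) : rn x ^+ 2 = q x.
Proof. by apply: rcI; rewrite rcX -rnE -hilbert_norm qE. Qed.

(** If no nonzero vector were orthogonal to the kernel of [phi], the kernel would be dense by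
    [total_dense], and the bounded [phi] would vanish. *)
Lemma riesz (U : hilbert R) (phi : U -> C) (M : R) :
  (forall a x y, phi (a *: x + y) = a * phi x + phi y) ->
  (forall x, rn (phi x) <= M * rn x) -> exists y, forall x, phi x = '[x, y].
Proof.
move=> lphi bphi; have lphi' : linear (phi : U -> C^o) by [].

have [H|/existsNP[x0 hx0]] := pselect (forall x, phi x = 0).
  by exists 0 => x; rewrite H f0r.
have p0 : phi 0 = 0 by exact: lin0 lphi'.
have sE : Defs.subspace [set x | phi x = 0].
  by split=> // a x y /= hx hy; rewrite lphi hx hy mulr0 addr0.
have [v [v0 vE]] : exists v : U, v <> 0 /\ forall y, phi y = 0 -> '[y, v] = 0.
  apply: contrapT => Hn.
  have dE : near_dense [set x | phi x = 0].
    apply: total_dense => // v hv; apply: contrapT => v0.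
    by apply: Hn; exists v.
  apply: hx0; apply/eqP; rewrite -rn_eq0 eq_le rn_ge0 andbT.
  apply/ler_addgt0Pl => e e0; rewrite addr0.
  have M0 : 0 < `|M| + 1 by rewrite ltr_wpDl.
  have [y /= hy yx] := dE x0 (e / (`|M| + 1)) (divr_gt0 e0 M0).
  have -> : phi x0 = phi (x0 - y).
    by rewrite (linB lphi') [phi y]hy subr0.
  apply: le_trans (bphi _) _; rewrite rnBC.
  move: yx; rewrite ltr_pdivlMr // => /ltW h; apply: le_trans h.
  by rewrite mulrC ler_wpM2l ?rn_ge0 // (le_trans (ler_norm M)) // lerDl.
(* Definiteness enters here: in a Hilbert space a nonzero vector is not neutral. *)
have vv : '[v, v] != 0.
  by rewrite qE -rn_q rc_eq0 sqrf_eq0 rn_eq0; apply/eqP.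
have pv : phi v != 0 by apply: contra_neq vv => /vE.
exists ((phi v / '[v, v])^* *: v) => x.
rewrite fZr conjCK.
have : phi (x - (phi x / phi v) *: v) = 0.
  by rewrite (linB lphi') (linZ lphi') /= [_ *: _]divfK // subrr.
move=> /vE; rewrite fBl fZl => /eqP; rewrite subr_eq0 => /eqP ->.
by field; rewrite vv pv.
Qed.

Lemma adjointE (U Y : hilbert R) (T : U -> Y) : bop T ->
  forall x y, '[T x, y] = '[x, adjoint T y].
Proof.
move=> bT x y; have [M M0 hM] := bop_bounded bT.
have [m m0 fm] := form_bounded Y.
have [z hz] : exists z : U, forall x, '[T x, y] = '[x, z].
  apply: (@riesz U (fun x => '[T x, y]) (m * M * rn y)) => [a u v|u].
    by rewrite bT.1 fDl fZl.
  apply: le_trans (fm _ _) _.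
  rewrite [leRHS](_ : _ = m * (M * rn u) * rn y); last by ring.
  by rewrite ler_wpM2r ?rn_ge0 // ler_pM2l.
have : [set x0 : U | forall x', '[T x', y] = '[x', x0]] (adjoint T y).
  by apply: xgetI hz.
by apply.
Qed.

Lemma adjointE' (U Y : hilbert R) (T : U -> Y) : bop T ->
  forall x y, '[y, T x] = '[adjoint T y, x].
Proof. by move=> bT x y; rewrite -fC adjointE // fC. Qed.

Lemma adjoint_unique (U Y : pontryagin R) (T : U -> Y) (y : Y) (z : U) :
  (forall x, '[T x, y] = '[x, z]) -> adjoint T y = z.
Proof.
move=> hz.
have h : [set x0 : U | forall x', '[T x', y] = '[x', x0]] (adjoint T y).
  by apply: xgetI hz.
by apply: form_inj => x; rewrite -fC -h hz fC.
Qed.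

Lemma adjoint_linear (U Y : hilbert R) (T : U -> Y) : bop T ->
  linear (adjoint T).
Proof.
move=> bT a x y; apply: adjoint_unique => z.
by rewrite !fDr !fZr !adjointE.
Qed.

(** The constant is independent of [T], so small operators have small adjoints; continuity and
    derivability thus pass from a function to its adjoints. *)
Lemma adjoint_bound (Y : hilbert R) : exists2 m : R, 0 < m &
  forall (U : hilbert R) (T : U -> Y) M, 0 <= M -> bop T ->
  (forall x, rn (T x) <= M * rn x) ->
  forall y, rn (adjoint T y) <= m * M * rn y.
Proof.
have [m m0 fm] := form_bounded Y; exists m => // U T M M0 bT hM y.
have [->|z0] := eqVneq (adjoint T y) 0.
  by rewrite rn0 !mulr_ge0 ?rn_ge0 // ltW.
have zp : 0 < rn (adjoint T y) by rewrite rn_gt0.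
rewrite -(ler_pM2r zp) -expr2 rn_q /q -adjointE //.
apply: le_trans (re_le _) _; apply: le_trans (fm _ _) _.
rewrite [leRHS](_ : _ = m * (M * rn (adjoint T y)) * rn y); last by ring.
by rewrite ler_wpM2r ?rn_ge0 // ler_pM2l.
Qed.

Lemma adjoint_bop (U Y : hilbert R) (T : U -> Y) : bop T -> bop (adjoint T).
Proof.
move=> bT; have [M M0 hM] := bop_bounded bT; have [m m0 am] := adjoint_bound Y.
apply: bopP (adjoint_linear bT) _; exact: am (ltW M0) bT hM.
Qed.

Lemma adjointK (U Y : hilbert R) (T : U -> Y) : bop T ->
  adjoint (adjoint T) = T.
Proof.
move=> bT; apply/funext => x; apply: adjoint_unique => y.
by rewrite adjointE'.
Qed.

Lemma isometricP (X : pontryagin R) (U Y : hilbert R) (Sigma : system X U Y) :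
  isometric Sigma <-> forall v w : psum X U,
    '[system_operator Sigma v, system_operator Sigma w] = '[v, w].
Proof.
set T := system_operator Sigma.
have T0 : T 0 = 0.
  rewrite /T /system_operator /=.
  rewrite (lin0 (main_opP Sigma).1) (lin0 (control_opP Sigma).1).
  rewrite (lin0 (observation_opP Sigma).1) (lin0 (feedthrough_opP Sigma).1).
  by rewrite !addr0.
split=> [iT v w|iT].
  have aw : adjoint T (T w) = w := congr1 (fun f => f w) iT.
  (* [adjoint] is 0 when no adjoint vector exists, so only a nonzero value proves existence. *)
  have [w0|w0] := eqVneq w 0; first by rewrite w0 T0 !f0r.
  have [z hz] : exists z : psum X U, forall x', '[T x', T w] = '[x', z].
    apply: contrapT => /forallNP Hn; move: aw.
    by rewrite /adjoint xgetPN // => /esym /eqP; rewrite (negbTE w0).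
  have := @adjoint_unique (psum X U) (psum X Y) T (T w) z hz.
  by rewrite aw hz => <-.
apply/funext => w.
exact: (@adjoint_unique (psum X U) (psum X Y) T (T w) w (fun v => iT v w)).
Qed.

End Operators.

(** * Extension of isometric relations *)

Section Extension.
Variable R : realType.
Notation C := (Cplx R).

Lemma lspan_subspace (V : lmodType C) (E : set V) : Defs.subspace (lspan E).
Proof.
split; first by exists 0%N, (fun=> 0), (fun=> 0); rewrite big_ord0; split=> // -[].
move=> c _ _ [n [a [v [Ev ->]]]] [m [a' [v' [Ev' ->]]]].
exists (n + m)%N, (fun i => match fintype.split i with
  | inl j => c * a j | inr j => a' j end), (fun i => match fintype.split i with
  | inl j => v j | inr j => v' j end); split.
  by move=> i; case: (fintype.split i).
rewrite big_split_ord /= scaler_sumr; congr (_ + _); apply: eq_bigr => i _.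
  by rewrite (unsplitK (inl _)) scalerA.
by rewrite (unsplitK (inr _)).
Qed.

Lemma sub_lspan (V : lmodType C) (E : set V) : E `<=` lspan E.
Proof.
move=> x Ex; exists 1%N, (fun=> 1), (fun=> x).
by rewrite big_ord1 scale1r.
Qed.

Lemma lspan_min (V : lmodType C) (E F : set V) : Defs.subspace F ->
  E `<=` F -> lspan E `<=` F.
Proof.
move=> [F0 sF] EF _ [n [a [v [Ev ->]]]].
elim: n a v Ev => [|n IH] a v Ev; first by rewrite big_ord0.
by rewrite big_ord_recr /= addrC; apply: (sF); [exact/EF/Ev|exact: IH].
Qed.

Lemma le_of_eps (x y K : R) : (forall e, 0 < e -> x <= y + K * e) -> x <= y.
Proof.
move=> h; apply/ler_addgt0Pr => e e0.
have K0 : 0 < `|K| + 1 by rewrite ltr_wpDl.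
apply: le_trans (h _ (divr_gt0 e0 K0)) _; rewrite lerD2l mulrA ler_pdivrMr //.
by rewrite mulrC ler_pM2l // (le_trans (ler_norm K)) // lerDl.
Qed.

Lemma eq0_of_eps (x K : R) : 0 <= x -> (forall e, 0 < e -> x <= K * e) -> x = 0.
Proof.
move=> x0 h; apply/eqP; rewrite eq_le x0 andbT.
by apply: (@le_of_eps _ _ K) => e e0; rewrite add0r h.
Qed.

Section Relation.
Variables (P P' : pontryagin R) (E : set (P * P')%type).
Hypothesis isoE : forall p p', E p -> E p' -> '[p.1, p'.1] = '[p.2, p'.2].
Hypothesis totE : forall x, (forall p, E p -> '[x, p.1] = 0) -> x = 0.

Let G := lspan E.

Let isoG p p' : G p -> G p' -> '[p.1, p'.1] = '[p.2, p'.2].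
Proof.
move=> Gp; apply: (@lspan_min _ E [set r | '[p.1, r.1] = '[p.2, r.2]]) => [|r Er].
  split=> /= [|a x y hx hy]; first by rewrite !f0r.
  by rewrite !fDr !fZr hx hy.
move: p Gp; apply: (@lspan_min _ E [set p | '[p.1, r.1] = '[p.2, r.2]]) => [|p Ep].
  split=> /= [|a x y hx hy]; first by rewrite !f0l.
  by rewrite !fDl !fZl hx hy.
exact: isoE.
Qed.

Let dom : set P := [set x | exists y, G (x, y)].

Let dom_subspace : Defs.subspace dom.
Proof.
have [G0 sG] := lspan_subspace E; split; first by exists 0.
move=> a x y [x' hx] [y' hy]; exists (a *: x' + y').
exact: (sG a (x, x') (y, y')).
Qed.

Let dom_dense : near_dense dom.
Proof.
apply: (total_dense dom_subspace) => x hx; apply: totE => -[y z] Ep /=.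
by rewrite -fC hx ?conjC0 //; exists z; exact: sub_lspan.
Qed.

Let negfam_transport : exists (b : 'I_(neg_index P) -> P) b',
  [/\ negfam b, negfam b' & forall i, G (b i, b' i)].
Proof.
have [b hb bD] := negfam_dense dom_subspace dom_dense.
have [b' hb'] := choice bD; exists b, b'; split=> // i j.
by rewrite -(isoG (hb' i) (hb' j)) hb.
Qed.

(* A maximal negative family can be chosen inside the dense domain; its image is
   again negative, of the same cardinality. *)
Lemma relation_neg_index_le : (neg_index P <= neg_index P')%N.
Proof. by have [b [b' [_ hb' _]]] := negfam_transport; exact: negfam_le hb'. Qed.

Hypothesis eq_index : neg_index P = neg_index P'.

(** Pairs of [G] have the same products with b and b' respectively, so [nb b] and [nb b'] agree on
    them. Equality of the indices makes b' maximal too, so that [nb b'] also dominates the squared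
    norm. *)
Let G_bounded : exists2 K : R, 0 < K & forall p, G p -> rn p.2 <= K * rn p.1.
Proof.
have [b [b' [hb hb' Gb]]] := negfam_transport.
have [K1 K10 H1] : exists2 K : R, 0 < K & forall x, rn x ^+ 2 <= K * nb b' x.
  by move: (b') hb'; rewrite eq_index => c hc; exact: negfam_equiv.
have [K2 K20 H2] := nb_bounded b.
exists (1 + K1 * K2) => [|p Gp]; first by rewrite ltr_pwDl // mulr_ge0 // ltW.
have K0 : 0 <= K1 * K2 by rewrite mulr_ge0 // ltW.
have nbE : nb b' p.2 = nb b p.1.
  rewrite /nb /q -isoG //; congr (_ + 2 * _); apply: eq_bigr => i _.
  by rewrite -(isoG Gp (Gb i)).
rewrite -(@ler_pXn2r _ 2) ?nnegrE ?rn_ge0 ?mulr_ge0 ?addr_ge0 ?rn_ge0 //.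
apply: le_trans (H1 _) _; rewrite nbE exprMn.
apply: le_trans (_ : K1 * K2 * rn p.1 ^+ 2 <= _); first by rewrite -mulrA ler_pM2l.
rewrite ler_wpM2r ?sqr_ge0 //.
by have := mulr_ge0 K0 K0; nra.
Qed.

(** The closure of [G]. [G_bounded] makes it single-valued and the density of [dom] makes it defined
    everywhere. *)
Let Cl x y := forall e : R, 0 < e ->
  exists p, [/\ G p, rn (p.1 - x) < e & rn (p.2 - y) < e].

Let Cl_ex x : exists y, Cl x y.
Proof.
have [K K0 HK] := G_bounded.
have /choice[u hu] : forall n : nat, exists p, G p /\ rn (p.1 - x) < n.+1%:R^-1.
  move=> n; have n0 : 0 < n.+1%:R^-1 :> R by rewrite invr_gt0.
  by have [y [y' Gy] hy] := dom_dense x n0; exists (y, y').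
have [l ul] : exists l, lim_seq (fun n => (u n).2) l.
  apply: lim_seq_cauchy => e e0.
  have h0 : 0 < e / (2 * K) by rewrite divr_gt0 // mulr_gt0.
  have [N HN] := small_inv h0; exists N => n m Nn Nm.
  have [G0 sG] := lspan_subspace E.
  have Gd : G (u n - u m).
    by rewrite addrC -scaleN1r; apply: (sG); [exact: (hu m).1|exact: (hu n).1].
  apply: le_lt_trans (HK _ Gd) _.
  have h1 := lt_trans (hu n).2 (HN n Nn).
  have h2 := lt_trans (hu m).2 (HN m Nm).
  have h3 : rn ((u n).1 - (u m).1) < e / K.
    have -> : (u n).1 - (u m).1 = ((u n).1 - x) - ((u m).1 - x).
      by rewrite opprB addrA subrK.
    apply: le_lt_trans (rnB _ _) _; apply: lt_le_trans (ltrD h1 h2) _.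
    by rewrite le_eqVlt (_ : _ == _) //; apply/eqP; field; rewrite gt_eqF.
  by move: h3; rewrite ltr_pdivlMr // mulrC.
exists l => e e0; have [N1 H1] := ul e e0; have [N2 H2] := small_inv e0.
exists (u (maxn N1 N2)); split; first exact: (hu _).1.
  by apply: lt_trans (hu _).2 _; apply: H2; exact: leq_maxr.
by apply: H1; exact: leq_maxl.
Qed.

Let Cl_lin a x x' y y' : Cl x y -> Cl x' y' -> Cl (a *: x + x') (a *: y + y').
Proof.
move=> h h' e e0; have [_ sG] := lspan_subspace E.
have A0 : 0 < rn a + 1 by rewrite ltr_wpDl ?rn_ge0.
have e' : 0 < e / (rn a + 1) / 2 by rewrite !divr_gt0.
have e2 : 0 < e / 2 by rewrite divr_gt0.
have [p [Gp p1 p2]] := h _ e'; have [p' [Gp' p1' p2']] := h' _ e2.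
have H (V : normedModType C) (u v : V) : rn u < e / (rn a + 1) / 2 ->
    rn v < e / 2 -> rn (a *: u + v) < e.
  move=> hu hv; apply: le_lt_trans (rnD _ _) _.
  rewrite [ltRHS]splitr; apply: ler_ltD => //; rewrite rnZ.
  apply: le_trans (ler_wpM2l (rn_ge0 a) (ltW hu)) _.
  have : rn a * (e / (rn a + 1)) <= e.
    by rewrite mulrCA ler_piMr ?(ltW e0) // ler_pdivrMr // mul1r lerDl.
  by move: (e / (rn a + 1)) => c; lra.
exists (a *: p + p'); split; first exact: sG.
  by rewrite /= opprD addrACA -scalerBr; apply: H.
by rewrite /= opprD addrACA -scalerBr; apply: H.
Qed.

Let Cl_bounded : exists2 K : R, 0 < K & forall x y, Cl x y -> rn y <= K * rn x.
Proof.
have [K K0 HK] := G_bounded; exists K => // x y xy.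
apply: (@le_of_eps _ _ (K + 1)) => e e0.
have [p [Gp p1 p2]] := xy e e0.
have h1 : rn y <= rn p.2 + rn (p.2 - y).
  by rewrite -{1}(subKr p.2 y) rnB.
have h2 : rn p.1 <= rn (p.1 - x) + rn x by rewrite -{1}(subrK x p.1) rnD.
have h3 := HK _ Gp; have : K * rn p.1 <= K * (e + rn x).
  by rewrite ler_pM2l //; lra.
by lra.
Qed.

Let Cl_form x y x' y' : Cl x y -> Cl x' y' -> '[y, y'] = '[x, x'].
Proof.
(* The limit is taken in one argument at a time, so this is applied twice. *)
have step u v z z' : Cl u v -> (forall p, G p -> '[p.2, z'] = '[p.1, z]) ->
    '[v, z'] = '[u, z].
  move=> uv hz; have [m m0 fm] := form_bounded P.
  have [m' m0' fm'] := form_bounded P'.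
  apply/eqP; rewrite -subr_eq0 -rn_eq0; apply/eqP.
  apply: (@eq0_of_eps _ (m' * rn z' + m * rn z)) (rn_ge0 _) _ => e e0.
  have [p [Gp p1 p2]] := uv e e0.
  have -> : '[v, z'] - '[u, z] = '[p.1 - u, z] - '[p.2 - v, z'].
    by rewrite !fBl hz //; ring.
  apply: le_trans (rnB _ _) _; rewrite addrC mulrDl.
  apply: lerD.
    apply: le_trans (fm' _ _) _; rewrite mulrAC.
    by rewrite ler_wpM2l ?mulr_ge0 ?rn_ge0 ?(ltW m0') // ltW.
  apply: le_trans (fm _ _) _; rewrite mulrAC.
  by rewrite ler_wpM2l ?mulr_ge0 ?rn_ge0 ?(ltW m0) // ltW.
move=> xy xy'; apply: (step) => // p Gp.
rewrite -fC -[RHS]fC; congr (_^*); apply: step => // r Gr.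
by rewrite isoG.
Qed.

Lemma isometric_extension : exists V : P -> P', [/\ linear V,
  exists2 K : R, 0 < K & forall x, rn (V x) <= K * rn x,
  forall x x', '[V x, V x'] = '[x, x'] &
  forall p, E p -> V p.1 = p.2].
Proof.
have [V hV] := choice Cl_ex; exists V.
have [K K0 HK] := Cl_bounded.
have uniq x y y' : Cl x y -> Cl x y' -> y = y'.
  move=> h h'; apply/eqP; rewrite -subr_eq0 -rn_eq0 eq_le rn_ge0 andbT.
  have := HK _ _ (Cl_lin (-1) h' h); rewrite !scaleN1r addNr rn0 mulr0.
  by rewrite addrC.
split=> [a x y||x x'|p Ep].
- exact: uniq (hV _) (Cl_lin a (hV x) (hV y)).
- by exists K => // x; apply: HK; exact: hV.
- by apply: Cl_form; exact: hV.
- apply: uniq (hV _) _ => e e0; exists p; split; first exact: sub_lspan.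
    by rewrite subrr rn0.
  by rewrite subrr rn0.
Qed.

End Relation.
End Extension.

(** * Kernel functions *)

Section Continuity.
Variable R : realType.
Notation C := (Cplx R).

Definition cts (V : normedModType C) (F : C -> V) (w0 : C) :=
  forall e : R, 0 < e -> exists2 d : R, 0 < d &
    forall w, rn (w - w0) < d -> rn (F w - F w0) < e.

Lemma ctsP (V : normedModType C) (F : C -> V) w0 :
  cts F w0 <-> F @ w0 --> F w0.
Proof.
split=> [h B /nbhs_rn[e e0 eB]|h e e0].
  have [d d0 H] := h e e0; apply/nbhs_rn; exists d => // w /H; exact: eB.
have : nbhs (F w0) [set y | rn (y - F w0) < e] by apply/nbhs_rn; exists e.
by move=> /h /nbhs_rn.
Qed.

Lemma cts_eq (V : normedModType C) (F G : C -> V) w0 :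
  (\forall w \near w0, F w = G w) -> cts F w0 -> cts G w0.
Proof.
move=> /nbhs_rn[r r0 FG] cF e e0; have [d d0 Hd] := cF e e0.
exists (Num.min r d); first by rewrite lt_min r0.
move=> w; rewrite lt_min => /andP[wr wd].
by rewrite -!FG ?Hd // subrr rn0.
Qed.

Lemma cts_ext (V : normedModType C) (F G : C -> V) w0 :
  F =1 G -> cts F w0 -> cts G w0.
Proof. by move=> /funext ->. Qed.

Lemma cts_cst (V : normedModType C) (c : V) w0 : cts (fun=> c) w0.
Proof. by move=> e e0; exists 1 => // w _; rewrite subrr rn0. Qed.

Lemma cts_id w0 : cts (fun w : C => w) w0.
Proof. by move=> e e0; exists e. Qed.

Lemma cts_conj (F : C -> C) w0 : cts F w0 -> cts (fun w => (F w)^*) w0.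
Proof.
move=> cF e /cF[d d0 Hd]; exists d => // w /Hd.
by rewrite -conjB rn_conj.
Qed.

Lemma ctsB (V : normedModType C) (F G : C -> V) w0 :
  cts F w0 -> cts G w0 -> cts (fun w => F w - G w) w0.
Proof. by move=> /ctsP cF /ctsP cG; apply/ctsP; exact: (cvgB cF cG). Qed.

Lemma ctsD (V : normedModType C) (F G : C -> V) w0 :
  cts F w0 -> cts G w0 -> cts (fun w => F w + G w) w0.
Proof. by move=> /ctsP cF /ctsP cG; apply/ctsP; exact: (cvgD cF cG). Qed.

Lemma ctsM (F G : C -> C) w0 :
  cts F w0 -> cts G w0 -> cts (fun w => F w * G w) w0.
Proof. by move=> /ctsP cF /ctsP cG; apply/ctsP; exact: (cvgM cF cG). Qed.

Lemma ctsV (F : C -> C) w0 : F w0 != 0 ->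
  cts F w0 -> cts (fun w => (F w)^-1) w0.
Proof. by move=> F0 /ctsP cF; apply/ctsP; exact: (cvgV F0 cF). Qed.

Lemma cts_sum n (F : 'I_n -> C -> C) w0 :
  (forall i, cts (F i) w0) -> cts (fun w => \sum_i F i w) w0.
Proof.
elim: n F => [|n IH] F cF.
  by apply: (@cts_ext _ (fun=> 0)); [move=> w; rewrite big_ord0|exact: cts_cst].
apply: (@cts_ext _ (fun w => \sum_i F (widen_ord (leqnSn n) i) w + F ord_max w)).
  by move=> w; rewrite big_ord_recr.
by apply: ctsD => //; exact: IH.
Qed.

Lemma cts_form (P : pontryagin R) (F G : C -> P) w0 :
  cts F w0 -> cts G w0 -> cts (fun w => '[F w, G w]) w0.
Proof.
move=> cF cG e e0; have [m m0 fm] := form_bounded P.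
set L := m * (1 + rn (F w0) + rn (G w0)).
have L0 : 0 < L by rewrite mulr_gt0 // -addrA ltr_pwDl // addr_ge0 ?rn_ge0.
have r0 : 0 < Num.min 1 (e / L) by rewrite lt_min ltr01 divr_gt0.
have [d1 d10 H1] := cF _ r0; have [d2 d20 H2] := cG _ r0.
exists (Num.min d1 d2); first by rewrite lt_min d10.
move=> w; rewrite lt_min => /andP[/H1 + /H2].
rewrite !lt_min => /andP[u1 ue] /andP[v1 ve].
set u := F w - F w0 in u1 ue; set v := G w - G w0 in v1 ve.
have -> : '[F w, G w] - '[F w0, G w0] = '[u, v] + '[u, G w0] + '[F w0, v].
  by rewrite /u /v !fBl !fBr; ring.
have [h1 h2 h3] : [/\ rn '[u, v] <= m * rn u, rn '[u, G w0] <= m * rn u * rn (G w0)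
    & rn '[F w0, v] <= m * rn (F w0) * rn v].
  split=> //; apply: le_trans (fm _ _) _; 
  by rewrite ler_piMr ?mulr_ge0 ?rn_ge0 ?(ltW m0) ?(ltW v1).
apply: le_lt_trans (rnD _ _) _.
have h4 := rnD '[u, v] '[u, G w0].
rewrite ltr_pdivlMr // in ue; rewrite ltr_pdivlMr // in ve.
have [uv|uv] := leP (rn u) (rn v).
  apply: le_lt_trans ve; rewrite /L.
  have : m * rn u <= m * rn v by rewrite ler_pM2l.
  have : m * rn u * rn (G w0) <= m * rn v * rn (G w0).
    by rewrite ler_wpM2r ?rn_ge0 // ler_pM2l.
  by lra.
apply: le_lt_trans ue; rewrite /L.
have : m * rn (F w0) * rn v <= m * rn (F w0) * rn u.
  by rewrite ler_wpM2l ?mulr_ge0 ?rn_ge0 ?(ltW m0) ?(ltW uv).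
by lra.
Qed.

(** Recovers the value at a point that was lost when an identity was divided by w. *)
Lemma cts_near0 (F : C -> C) w0 (r : R) : 0 < r -> cts F w0 ->
  (forall w, w != w0 -> rn (w - w0) < r -> F w = 0) -> F w0 = 0.
Proof.
move=> r0 cF h; apply/eqP; rewrite -rn_eq0; apply/eqP.
apply: (@eq0_of_eps _ _ 1) (rn_ge0 _) _ => e e0; rewrite mul1r.
have [d d0 Hd] := cF e e0.
set t := Num.min r d / 2.
have t0 : 0 < Num.min r d by rewrite lt_min r0.
have t2 : 0 < t by rewrite divr_gt0.
have tt : t < Num.min r d by rewrite /t; lra.
move: tt; rewrite lt_min => /andP[tr td].
have hw : rn (w0 + rc t - w0) = t by rewrite addrC addKr rn_rc ?ltW.
have := Hd (w0 + rc t); rewrite hw => /(_ td).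
rewrite h ?hw //; first by rewrite sub0r rnN => /ltW.
by rewrite -subr_eq0 -rn_eq0 hw gt_eqF.
Qed.

End Continuity.

(** * Kernel vectors and their continuity in the point *)

Section Kernel.
Variable R : realType.
Notation C := (Cplx R).
Variables (V W : hilbert R) (s : C -> V -> W) (H : rkps s).
Hypothesis hs : holomorphic_at s 0.

Lemma rhoP w : rho s w <-> rn w < 1 /\ holomorphic_at s w.
Proof. by rewrite /rho /= rnE -rc1 lt_rc. Qed.

Lemma rho_near w : rho s w -> \forall z \near w, rho s z.
Proof.
move=> /rhoP[w1 hw]; have : \forall z \near w, holomorphic_at s z.
  by move/nbhs_interior: hw.
have : \forall z \near w, rn z < 1.
  apply/nbhs_rn; exists (1 - rn w); first by rewrite subr_gt0.
  by move=> z h; have := rnD (z - w) w; rewrite subrK; lra.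
by apply: filterS2 => z h1 h2; apply/rhoP.
Qed.

Lemma rho0 : rho s 0.
Proof. by apply/rhoP; rewrite rn0. Qed.

Lemma rho_bop w : rho s w -> bop (s w).
Proof. by move=> /rhoP[_ /nbhs_singleton[]]. Qed.

Definition is_kernel_at w f : set H :=
  [set k | (forall z, rho s z -> rk_eval k z = schur_kernel s w z f) /\
    (forall h : H, '[h, k] = '[rk_eval h w, f])].

Definition kf w f : H := xget 0 (is_kernel_at w f).

Lemma kf_spec w f : rho s w -> is_kernel_at w f (kf w f).
Proof.
by move=> rw; have [k hk] := rk_reproducing H f rw; exact: (xgetI 0 hk).
Qed.

Lemma kf_rep w f (h : H) : rho s w -> '[h, kf w f] = '[rk_eval h w, f].
Proof. by move=> rw; have [_] := kf_spec f rw. Qed.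

Lemma one_sub_neq0 (w z : C) : rn w < 1 -> rn z < 1 -> 1 - z * w^* != 0.
Proof.
move=> w1 z1; rewrite subr_eq0; apply/eqP => e.
have := rnM z w^*; rewrite -e rn1 rn_conj => h.
have := rn_ge0 w; have := rn_ge0 z; nra.
Qed.

Definition gram w z f g : C :=
  (1 - z * w^*)^-1 * ('[f, g] - '[adjoint (s w) f, adjoint (s z) g]).

Lemma kf_gram w z f g : rho s w -> rho s z -> '[kf w f, kf z g] = gram w z f g.
Proof.
move=> rw rz; rewrite kf_rep // (kf_spec f rw).1 // /schur_kernel fZl fBl.
by rewrite adjointE //; exact: rho_bop.
Qed.

Lemma kf_total (h : H) : (forall w f, rho s w -> '[h, kf w f] = 0) -> h = 0.
Proof.
move=> h0; apply: rk_eval_inj => z rz.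
rewrite (lin0 (rk_eval_linear rz)); apply: nondeg => f.
by rewrite -kf_rep // h0.
Qed.

(** The derivative, with error constant 1, gives a local Lipschitz estimate in operator norm, and
    [adjoint_bound] carries it to the adjoints. *)
Lemma cts_adjoint w0 f : rho s w0 -> cts (fun w => adjoint (s w) f) w0.
Proof.
move=> rw0; have [_ /nbhs_singleton[b0 [T [bT dT]]]] := rw0.
have [M M0 hM] := bop_bounded bT; have [m m0 hm] := adjoint_bound W.
have [r r0 Hr] : exists2 r : R, 0 < r & forall w, rn (w - w0) < r ->
    rho s w /\ forall u, rn (s w u - s w0 u) <= (1 + M) * rn (w - w0) * rn u.
  have /nbhs_rn[r1 r10 H1] := rho_near rw0.
  have /nbhs_rn[r2 r20 H2] := dT 1 ltr01.
  exists (Num.min r1 r2); first by rewrite lt_min r10.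
  move=> w; rewrite lt_min => /andP[/H1 rw /H2 h]; split=> // u.
  have := h u; rewrite !rnE mul1r -rcM le_rc => h'.
  have := rnD (s w u - s w0 u - (w - w0) *: T u) ((w - w0) *: T u).
  rewrite subrK rnZ => h2.
  have : rn (w - w0) * rn (T u) <= rn (w - w0) * (M * rn u).
    by rewrite ler_wpM2l ?rn_ge0.
  by lra.
move=> e e0.
set L := m * (1 + M) * (rn f + 1).
have L0 : 0 < L.
  have f0 : 0 < rn f + 1 by rewrite ltr_wpDl ?rn_ge0.
  by rewrite !mulr_gt0 // ltr_pwDl // ltW.
exists (Num.min r (e / L)); first by rewrite lt_min r0 divr_gt0.
move=> w; rewrite lt_min => /andP[/Hr[rw hw] we].
have bw := rho_bop rw.
pose D v := s w v - s w0 v.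
have bD : bop D.
  apply: (@bopP _ _ _ _ ((1 + M) * rn (w - w0))); last exact: hw.
  by move=> a x y; rewrite /D bw.1 b0.1 scalerBr opprD addrACA.
have -> : adjoint (s w) f - adjoint (s w0) f = adjoint D f.
  symmetry; apply: adjoint_unique => x.
  by rewrite fBl fBr !adjointE.
have M1 : 0 <= (1 + M) * rn (w - w0).
  by rewrite mulr_ge0 ?rn_ge0 // addr_ge0 // ltW.
apply: le_lt_trans (hm _ _ _ M1 bD hw f) _.
move: we; rewrite ltr_pdivlMr //; apply: le_lt_trans; rewrite /L.
rewrite [leLHS](_ : _ = rn (w - w0) * (m * (1 + M) * rn f)); last by ring.
rewrite ler_wpM2l ?rn_ge0 // ler_wpM2l ?lerDl //.
by rewrite mulr_ge0 ?addr_ge0 // ltW.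
Qed.

Definition kspan : set H :=
  lspan [set k | exists z f, rho s z /\ k = kf z f].

Lemma kspan_dense : near_dense kspan.
Proof.
apply: (total_dense (lspan_subspace _)) => h h0; apply: kf_total => w f rw.
rewrite -fC h0 ?conjC0 //; apply: sub_lspan.
by exists w, f.
Qed.

Lemma cts_kf_form w0 f k : rho s w0 -> kspan k ->
  cts (fun w => '[kf w f, k]) w0.
Proof.
move=> rw0 kk; have hr := rho_near rw0.
apply: (@lspan_min _ _ [set k | exists z f, rho s z /\ k = kf z f]
  [set k | cts (fun w => '[kf w f, k]) w0]) kk => [|_ [z [g [rz ->]]]].
  split=> [|a x y /= hx hy].
    by apply: (@cts_ext _ _ (fun=> 0)); [move=> w; rewrite f0r|exact: cts_cst].
  apply: (@cts_ext _ _ (fun w => a^* * '[kf w f, x] + '[kf w f, y])).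
    by move=> w; rewrite fDr fZr.
  by apply: ctsD => //; apply: ctsM => //; exact: cts_cst.
apply: (@cts_eq _ _ (fun w => gram w z f g)).
  by apply: filterS hr => w rw; rewrite kf_gram.
have [w1 _] := (rhoP _).1 rw0; have [z1 _] := (rhoP _).1 rz.
apply: ctsM.
  apply: ctsV; first exact: one_sub_neq0.
  apply: ctsB; first exact: cts_cst.
  by apply: ctsM; [exact: cts_cst|apply: cts_conj; exact: cts_id].
apply: ctsB; first exact: cts_cst.
by apply: cts_form; [exact: cts_adjoint|exact: cts_cst].
Qed.

Lemma kf_kspan w f : rho s w -> kspan (kf w f).
Proof. by move=> rw; apply: sub_lspan; exists w, f. Qed.

(* The norm of k_w f - k_{w0} f is controlled by finitely many values of the
   kernel, the maximal negative family being chosen in the span of the kernel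
   functions. *)
Lemma cts_kf w0 f : rho s w0 -> cts (fun w => kf w f) w0.
Proof.
move=> rw0; have hr := rho_near rw0.
have [b hb bk] := negfam_dense (lspan_subspace _) kspan_dense.
have [K K0 HK] := negfam_equiv hb.
pose x w := kf w f - kf w0 f.
have cxb k : kspan k -> cts (fun w => '[x w, k]) w0.
  move=> kk; apply: (@cts_ext _ _ (fun w => '[kf w f, k] - '[kf w0 f, k])).
    by move=> w; rewrite fBl.
  by apply: ctsB; [exact: cts_kf_form|exact: cts_cst].
have cxx : cts (fun w => '[x w, x w]) w0.
  apply: (@cts_eq _ _ (fun w => gram w w f f - '[kf w f, kf w0 f]
      - ('[kf w f, kf w0 f]^* - '[kf w0 f, kf w0 f]))).
    by apply: filterS hr => w rw; rewrite /x fBl !fBr fC (kf_gram f f rw rw) opprB.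
  have k0 := kf_kspan f rw0; have c0 := cts_kf_form f rw0 k0.
  have [w1 _] := (rhoP _).1 rw0.
  apply: ctsB; apply: ctsB => //; last exact: cts_cst; last exact: cts_conj.
  apply: ctsM.
    apply: ctsV; first exact: one_sub_neq0.
    apply: ctsB; first exact: cts_cst.
    by apply: ctsM; [exact: cts_id|apply: cts_conj; exact: cts_id].
  apply: ctsB; first exact: cts_cst.
  by apply: cts_form; exact: cts_adjoint.
have ch : cts (fun w => hform b (x w) (x w)) w0.
  apply: (@cts_ext _ _ (fun w => '[x w, x w] +
      2 * \sum_i '[x w, b i] * '[x w, b i]^*)).
    move=> w; rewrite hformE; congr (_ + 2 * _); apply: eq_bigr => i _.
    by rewrite fC.
  apply: ctsD => //; apply: ctsM; first exact: cts_cst.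
  apply: cts_sum => i; apply: ctsM; last apply: cts_conj; exact: (cxb _ (bk i)).
move=> e e0; have h0 : 0 < e ^+ 2 / K by rewrite divr_gt0 // exprn_gt0.
have x0 : hform b (x w0) (x w0) = 0 by rewrite /x subrr; exact: f0l.
have [d d0 Hd] := ch _ h0; exists d => // w /Hd.
rewrite x0 subr0 ltr_pdivlMr // -/(x w) => h.
rewrite -(@ltr_pXn2r _ 2) ?nnegrE ?rn_ge0 ?(ltW e0) //.
apply: le_lt_trans (HK _) _; apply: le_lt_trans h; rewrite mulrC ler_pM2r //.
by rewrite -hform_nb re_le.
Qed.

(** The point 0 is excluded because [w^* *: kf w f] vanishes there; continuity of the kernel vectors
    recovers it. *)
Lemma kf_total0 (h : H) :
  (forall w f, rho s w -> w != 0 -> '[h, kf w f] = 0) -> h = 0.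
Proof.
move=> h0; apply: kf_total => w f rw.
have [->|w0] := eqVneq w 0; last exact: h0.
have /nbhs_rn[r r0 Hr] := rho_near rho0.
apply: (@cts_near0 _ (fun w => '[h, kf w f]) 0 r r0).
  by apply: cts_form; [exact: cts_cst|apply: cts_kf; exact: rho0].
by move=> z z0 zr; exact: h0 (Hr z zr) z0.
Qed.

End Kernel.

Lemma psumE (R : realType) (X Y : pontryagin R) (p p' : psum X Y) :
  '[p, p'] = '[p.1, p'.1] + '[p.2, p'.2] :> Cplx R.
Proof. by []. Qed.

(** * The adjoint of the backward shift *)

Section Shift.
Variable R : realType.
Notation C := (Cplx R).
Variables (V W : hilbert R) (s : C -> V -> W) (H : rkps s).
Hypothesis hs : holomorphic_at s 0.
Local Notation kf := (kf H).

(* The kernel identity makes (w^* k_w f) |-> (k_w f - k_0 f, s(w)^* f - s(0)^* f)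
   isometric into H (+) V; [A] is its first component, the adjoint of the
   backward shift h |-> (h(z) - h(0)) / z. *)
Lemma shift_exists : exists A : H -> H, [/\ linear A,
  exists2 K : R, 0 < K & forall x, rn (A x) <= K * rn x,
  forall x, q (A x) <= q x &
  forall w f, rho s w -> w^* *: A (kf w f) = kf w f - kf 0 f].
Proof.
pose P' := psum H V.
pose E : set (H * P')%type := [set p | exists w f, rho s w /\
  p = (w^* *: kf w f, (kf w f - kf 0 f, adjoint (s w) f - adjoint (s 0) f))].
have iE p p' : E p -> E p' -> '[p.1, p'.1] = '[p.2, p'.2].
  move=> [w [f [rw ->]]] [z [g [rz ->]]] /=.
  rewrite fZl fZr conjCK psumE /=.
  have r0 := rho0 hs; rewrite !fBl !fBr (kf_gram H _ _ rw rz) (kf_gram H _ _ r0 rz).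
  rewrite (kf_gram H _ _ rw r0) (kf_gram H _ _ r0 r0).
  rewrite /gram !conjC0 !mul0r !mulr0 !subr0 !invr1 !mul1r.
  have [w1 _] := (rhoP _ _).1 rw; have [z1 _] := (rhoP _ _).1 rz.
  by field; exact: one_sub_neq0.
have tE x : (forall p, E p -> '[x, p.1] = 0) -> x = 0.
  move=> hx; apply: (kf_total0 hs) => w f rw w0.
  have : E (w^* *: kf w f, (kf w f - kf 0 f, adjoint (s w) f - adjoint (s 0) f)).
    by exists w, f.
  move=> /hx /=; rewrite fZr conjCK => /eqP; rewrite mulf_eq0 (negbTE w0).
  by move/eqP.
have ind : neg_index H = neg_index P' by rewrite /= hilbert_index addn0.
have [T [lT [K K0 HK] iT eT]] := isometric_extension iE tE ind.
exists (fun x => (T x).1); split.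
- by move=> a x y; rewrite lT.
- exists K => // x; apply: le_trans (HK x).
  rewrite -le_rc -!rnE [`|T x|]/(Num.max _ _) /=.
  rewrite !rnE /Num.max /Order.max lt_rc.
  by case: ltP => // /ltW; rewrite le_rc.
(* The discarded component lies in the Hilbert space [V] and has nonnegative square. *)
- move=> x; have := iT x x.
  rewrite psumE !qE -rcD => /rcI <-; rewrite lerDl -rn_q; exact: sqr_ge0.
- move=> w f rw.
  have Ep : E (w^* *: kf w f, (kf w f - kf 0 f, adjoint (s w) f - adjoint (s 0) f)).
    by exists w, f.
  by have := congr1 fst (eT _ Ep); rewrite /= (linZ lT).
Qed.

End Shift.

(** * The identity theorem in H(S) *)

Section Moments.
Variable R : realType.
Notation C := (Cplx R).

Lemma iter_linear (V : lmodType C) (A : V -> V) n :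
  linear A -> linear (iter n A).
Proof. by move=> lA; elim: n => [//|n IH] a x y; rewrite !iterS IH lA. Qed.

Lemma iter_bounded (V : normedModType C) (A : V -> V) (K : R) n : 0 < K ->
  (forall x, rn (A x) <= K * rn x) -> forall x, rn (iter n A x) <= K ^+ n * rn x.
Proof.
move=> K0 hA x; elim: n => [|n IH]; first by rewrite expr0 mul1r.
rewrite iterS; apply: le_trans (hA _) _.
by rewrite exprS -mulrA ler_pM2l.
Qed.

Lemma cts_lin (V V' : normedModType C) (T : V -> V') (K : R) (F : C -> V) w0 :
  linear T -> 0 < K -> (forall x, rn (T x) <= K * rn x) ->
  cts F w0 -> cts (fun w => T (F w)) w0.
Proof.
move=> lT K0 bT cF e e0; have [d d0 Hd] := cF _ (divr_gt0 e0 K0).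
exists d => // w /Hd; rewrite ltr_pdivlMr // mulrC -(linB lT).
exact: le_lt_trans.
Qed.

(** Induction on n for all small w at once: A^n applied to the hypothesis on [k] gives w^* A^(n+1)
    k_w = A^n k_w - A^n k_0. Division by w^* covers the nonzero w, and continuity covers 0. It
    serves both for kernel vectors and for states. *)
Lemma moments (X : pontryagin R) (A : X -> X) (K r : R) (k : C -> X) (h : X) :
  linear A -> 0 < K -> (forall x, rn (A x) <= K * rn x) -> 0 < r ->
  cts k 0 -> (forall w, rn w < r -> w^* *: A (k w) = k w - k 0) ->
  (forall w, rn w < r -> '[k w, h] = 0) ->
  forall n, '[iter n A (k 0), h] = 0.
Proof.
move=> lA K0 bA r0 ck hk kh n.
suff H w : rn w < r -> '[iter n A (k w), h] = 0 by apply: H; rewrite rn0.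
elim: n w => [|n IH] w wr; first exact: kh.
have H w' : w' != 0 -> rn w' < r -> '[iter n.+1 A (k w'), h] = 0.
  move=> w0 wr'; have : '[iter n A (w'^* *: A (k w')), h] = 0.
    by rewrite hk // (linB (iter_linear n lA)) fBl !IH ?rn0 // subr0.
  rewrite (linZ (iter_linear n lA)) fZl -iterSr => /eqP.
  by rewrite mulf_eq0 conjC_eq0 (negbTE w0) => /eqP.
have [w0|w0] := eqVneq w 0; last exact: H.
rewrite w0; apply: (@cts_near0 _ (fun w => '[iter n.+1 A (k w), h]) 0 r r0).
  apply: cts_form; last exact: cts_cst.
  apply: (cts_lin (iter_linear n.+1 lA) (exprn_gt0 n.+1 K0)) => //.
  exact: iter_bounded.
by move=> w'; rewrite subr0; exact: H.
Qed.

Lemma exp_growth (x D G : R) : 1 < x -> 0 < D ->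
  exists N : nat, forall n, (N <= n)%N -> G < x ^+ n * D.
Proof.
move=> x1 D0; have x0 : 0 < x - 1 by rewrite subr_gt0.
have bern n : n%:R * (x - 1) <= x ^+ n.
  elim: n => [|n IH]; first by rewrite mul0r expr0.
  have : 1 <= x ^+ n by rewrite exprn_ege1 // ltW.
  rewrite exprS mulrSr; nra.
exists (Num.truncn (`|G| / D / (x - 1))).+1 => n Nn.
apply: le_lt_trans (ler_norm G) _; rewrite -ltr_pdivrMr //.
apply: lt_le_trans (bern n); rewrite -ltr_pdivrMr //.
apply: lt_le_trans (truncnS_gt _) _.
by rewrite ler_nat.
Qed.

Section PolyApply.
Variables (X : pontryagin R) (A : X -> X) (lam : nat -> C).
Hypothesis lA : linear A.

(** The product of the operators A - lam_j over the list. *)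
Fixpoint annih (js : seq nat) (x : X) : X :=
  if js is j :: js' then annih js' (A x - lam j *: x) else x.

Lemma annih_linear js : linear (annih js).
Proof.
elim: js => [//|j js IH] a x y /=; rewrite -IH; congr annih.
by rewrite lA scalerBr !scalerDr !scalerA opprD addrACA [lam j * a]mulrC.
Qed.

Lemma annih_bounded (K : R) js : 0 < K -> (forall x, rn (A x) <= K * rn x) ->
  exists2 M : R, 0 < M & forall x, rn (annih js x) <= M * rn x.
Proof.
move=> K0 bA; elim: js => [|j js [M M0 hM]].
  by exists 1 => // x; rewrite mul1r.
exists (M * (K + rn (lam j))) => [|x /=].
  by rewrite mulr_gt0 // ltr_pwDl ?rn_ge0.
apply: le_trans (hM _) _; rewrite -mulrA ler_pM2l //.
apply: le_trans (rnB _ _) _; rewrite mulrDl rnZ.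
by rewrite lerD2r.
Qed.

(** Seen through products with h, x behaves like an eigenvector for l, even if A x is not l x. *)
Lemma annih_eigen (h x : X) (l c : C) :
  (forall n, '[iter n A x, h] = l ^+ n * c) ->
  forall js n, '[annih js (iter n A x), h] =
    (\prod_(j <- js) (l - lam j)) * (l ^+ n * c).
Proof.
move=> hx; elim=> [|j js IH] n /=; first by rewrite big_nil mul1r.
rewrite (linB (annih_linear js)) (linZ (annih_linear js)) fBl fZl.
by rewrite -iterS !IH big_cons exprS; ring.
Qed.

End PolyApply.

(** Dividing by a coefficient of largest modulus bounds the combination independently of [M], while
    one coefficient is prevented from being small. *)
Lemma normalized_kernel (m : nat) (M : 'M[C]_(m.+1, m)) :
  exists a : 'I_m.+1 -> C, [/\ forall j, \sum_i a i * M i j = 0,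
    forall i, rn (a i) <= 1 & exists i, rn (a i) = 1].
Proof.
have [a a0 aM] := ker_ex M (ltnSn m).
have [i0 _ hi0] := @Order.TotalTheory.arg_maxP _ R 'I_m.+1 ord0 xpredT
  (fun i => rn (a 0 i)) isT.
have ai0 : 0 < rn (a 0 i0).
  rewrite lt_neqAle rn_ge0 andbT; apply: contra a0 => /eqP e.
  apply/eqP/rowP => i; rewrite mxE; apply/eqP; rewrite -rn_eq0 eq_le rn_ge0 andbT.
  by rewrite e; exact: hi0.
exists (fun i => (a 0 i0)^-1 * a 0 i); split=> [j|i|].
- under eq_bigr do rewrite -mulrA; rewrite -mulr_sumr.
  have := congr1 (fun A : 'rV_ _ => A 0 j) aM; rewrite mxE [RHS]mxE => ->.
  by rewrite mulr0.
- by rewrite rnM rnV mulrC ler_pdivrMr // mul1r; exact: hi0.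
- by exists i0; rewrite rnM rnV mulVf // gt_eqF.
Qed.

End Moments.

Section Identity.
Variable R : realType.
Notation C := (Cplx R).
Variables (V W : hilbert R) (s : C -> V -> W) (H : rkps s).
Hypothesis hs : holomorphic_at s 0.
Local Notation kf := (kf H).

(* Suppose h vanishes near 0 and <h, k_w f> <> 0 at kappa + 1 points w_i.  Modulo
   h^perp, which contains all A^n k_0 f, the k_{w_i} f are eigenvectors of A for
   the distinct eigenvalues l_i = 1 / w_i^*, |l_i| > 1.  For every n some
   normalized combination x of them has A^n x orthogonal to a maximal negative
   subspace, so that A^n x is bounded by <A^n x, A^n x> <= <x, x>.  Pairing
   prod_{j <> i} (A - l_j) A^n x with h then bounds a_i l_i^n for each
   coefficient a_i of x, which is impossible for large n. *)
Lemma rk_identity (h : H) : (\forall z \near (0 : C), rk_eval h z = 0) -> h = 0.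
Proof.
move=> /nbhs_rn[r1 r10 h0].
have [A [lA [K K0 bA] qA sA]] := shift_exists H hs.
apply: kf_total => w0 f rw0; apply/eqP/negPn/negP => hw0.
have [d d0 Hd] : exists2 d : R, 0 < d & forall w, rn (w - w0) < d ->
    rho s w /\ '[kf w f, h] != 0.
  have [d1 d10 H1] := (nbhs_rn _ _).1 (rho_near rw0).
  have ck : cts (fun w => '[h, kf w f]) w0.
    by apply: cts_form; [exact: cts_cst|exact: cts_kf].
  have hp : 0 < rn '[h, kf w0 f] by rewrite rn_gt0.
  have [d2 d20 H2] := ck _ hp.
  exists (Num.min d1 d2); first by rewrite lt_min d10.
  move=> w; rewrite lt_min => /andP[/H1 rw /H2 hw]; split; first exact: rw.
  apply: contraTneq hw => e; rewrite -leNgt -(fC h (kf w f)) e conjC0 sub0r rnN.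
  exact: lexx.
set kappa := neg_index H.
(* Pairwise distinct points; the denominator starts at 2 so that all of them are strictly within d
   of [w0]. *)
pose w (i : nat) : C := w0 + rc (d / i.+2%:R).
have wd i : rn (w i - w0) < d.
  rewrite /w addrC addKr rn_rc ?divr_ge0 ?(ltW d0) //.
  by rewrite ltr_pdivrMr ?ltr0n // ltr_pMr // ltr1n.
have rw i : rho s (w i) := (Hd _ (wd i)).1.
have cw i : '[kf (w i) f, h] != 0 := (Hd _ (wd i)).2.
have [r r0 hr] : exists2 r : R, 0 < r & forall z, rn z < r ->
    rho s z /\ rk_eval h z = 0.
  have [r2 r20 h2] := (nbhs_rn _ _).1 (rho_near (rho0 hs)).
  exists (Num.min r1 r2); first by rewrite lt_min r10.
  move=> z; rewrite lt_min => /andP[z1 z2]; split; first by apply: h2; rewrite subr0.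
  by apply: h0; rewrite subr0.
have kh z : rn z < r -> '[kf z f, h] = 0.
  by move=> /hr[rz hz]; rewrite -fC kf_rep // hz f0l conjC0.
have w_neq0 i : w i != 0.
  by apply: contraNneq (cw i) => ->; rewrite kh ?rn0.
have mom n : '[iter n A (kf 0 f), h] = 0.
  apply: (@moments _ _ A K r (fun z => kf z f) h lA K0 bA r0 _ _ kh n).
    exact: (cts_kf _ _ (rho0 hs)).
  by move=> z /hr[rz _]; exact: sA.
pose lam i := ((w i)^*)^-1.
have lam1 i : 1 < rn (lam i).
  have /rhoP[w1 _] := rw i.
  by rewrite rnV rn_conj invf_gt1 // rn_gt0.
have Ak i : A (kf (w i) f) = lam i *: (kf (w i) f - kf 0 f).
  rewrite -(sA _ _ (rw i)) scalerA mulVf ?scale1r //.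
  by rewrite conjC_eq0.
have eig i n : '[iter n A (kf (w i) f), h] = lam i ^+ n * '[kf (w i) f, h].
  elim: n => [|n IH]; first by rewrite mul1r.
  rewrite iterSr Ak (linZ (iter_linear n lA)) (linB (iter_linear n lA)).
  by rewrite fZl fBl mom subr0 IH exprS mulrA.
have sT : Defs.subspace [set: H] by [].
have [b hb _] := negfam_dense sT (@near_denseT _ H).
have [K' K'0 HK'] := negfam_equiv hb.
have [dq dq0 hq] := q_bounded H.
have [m m0 fm] := form_bounded H.
pose S := \sum_(i < kappa.+1) rn (kf (w i) f).
have S0 : 0 <= S by apply: sumr_ge0 => i _; exact: rn_ge0.
pose B := Num.sqrt (K' * (dq * S ^+ 2)).
pose js (i : 'I_kappa.+1) := [seq val j | j <- enum 'I_kappa.+1 & j != i].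
have /choice[M hM] : forall i, exists M : R, 0 < M /\
    forall x, rn (annih A lam (js i) x) <= M * rn x.
  by move=> i; have [M M0 ?] := annih_bounded lam (js i) K0 bA; exists M.
pose D (i : 'I_kappa.+1) := (\prod_(j <- js i) (lam i - lam j)) * '[kf (w i) f, h].
have w_inj i j : w i = w j -> i = j.
  move=> /addrI /rcI /(mulfI (lt0r_neq0 d0)) /invr_inj /eqP.
  by rewrite eqr_nat => /eqP[].
have D0 i : D i != 0.
  rewrite mulf_neq0 // prodf_seq_neq0; apply/allP => _ /mapP[j + ->] /=.
  rewrite mem_filter => /andP[ji _]; rewrite subr_eq0.
  apply: contra ji => /eqP /invr_inj /(can_inj (@conjCK C)) /w_inj /val_inj <-.
  exact: eqxx.
have /choice[N hN] : forall i : 'I_kappa.+1, exists N : nat, forall n, (N <= n)%N ->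
    m * (M i * B) * rn h < rn (lam i) ^+ n * rn (D i).
  by move=> i; apply: exp_growth => //; rewrite rn_gt0.
(* The index [i0] found below depends on n, so n has to exceed every [N i]. *)
pose n := (\sum_i N i)%N.
have [a [aM a1 [i0 ai0]]] :=
  normalized_kernel
    (\matrix_(i < kappa.+1, j < kappa) '[iter n A (kf (w i) f), b j]).
pose x := \sum_i a i *: kf (w i) f.
pose y := iter n A x.
have yE : y = \sum_i a i *: iter n A (kf (w i) f).
  by rewrite /y (lin_sum (iter_linear n lA)).
have yb j : '[y, b j] = 0.
  rewrite yE fsuml -[RHS](aM j); apply: eq_bigr => i _.
  by rewrite fZl mxE.
have qy : q y <= q x.
  rewrite /y; elim: (n) => [//|n' IH]; rewrite iterS.
  exact: le_trans (qA _) IH.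
have xS : rn x <= S.
  apply: le_trans (rn_sum _) _; apply: ler_sum => i _.
  by rewrite rnZ ler_piMl ?rn_ge0.
have yB : rn y <= B.
  rewrite -(ger0_norm (rn_ge0 y)) -sqrtr_sqr ler_wsqrtr //.
  apply: le_trans (HK' _) _; rewrite ler_pM2l // /nb big1 => [|j _]; last first.
    by rewrite yb rn0 expr0n.
  rewrite mulr0 addr0; apply: le_trans qy _.
  apply: le_trans (ler_norm _) _; apply: le_trans (hq x) _.
  by rewrite ler_pM2l // lerXn2r ?nnegrE ?rn_ge0.
have : '[annih A lam (js i0) y, h] = a i0 * (lam i0 ^+ n * D i0).
  rewrite yE (lin_sum (annih_linear lam lA (js i0))) fsuml (bigD1 i0) //=.
  rewrite [X in _ + X]big1 ?addr0 => [|i ii0].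
    rewrite fZl (annih_eigen lam lA (eig i0)) /D; congr (_ * _).
    by rewrite mulrCA.
  rewrite fZl (annih_eigen lam lA (eig i)).
  have iin : val i \in js i0.
    by apply: map_f; rewrite mem_filter ii0 mem_enum.
  by rewrite (big_rem _ iin) /= subrr !mul0r mulr0.
move=> /(congr1 (@rn R _)); rewrite rnM ai0 mul1r rnM rnX => e.
have Nn : (N i0 <= n)%N by rewrite /n (bigD1 i0) //= leq_addr.
have := hN i0 n Nn; rewrite -e ltNge; apply/negP/negPn.
apply: le_trans (fm _ _) _; rewrite ler_wpM2r ?rn_ge0 // ler_pM2l //.
have [M0 hMi] := hM i0; apply: le_trans (hMi _) _.
by rewrite ler_pM2l.
Qed.

End Identity.

(** * Germs at 0 and the unitary model *)

Section Model.
Variable R : realType.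
Notation C := (Cplx R).

Section Germs.
Variables (V W : hilbert R) (s : C -> V -> W) (H : rkps s).
Hypothesis hs : holomorphic_at s 0.

Lemma rho_ball : exists2 r : R, 0 < r & forall w, rn w < r -> rho s w.
Proof.
have [r r0 hr] := (nbhs_rn _ _).1 (rho_near (rho0 hs)).
by exists r => [//|w wr]; apply: hr; rewrite subr0.
Qed.

Lemma has_germP (h : H) g : has_germ h g <->
  exists2 r : R, 0 < r & forall w, rn w < r -> rk_eval h w = g w.
Proof.
split=> [/nbhs_rn[r r0 hr]|[r r0 hr]].
  by exists r => [//|w wr]; apply: hr; rewrite subr0.
by apply/nbhs_rn; exists r => // w; rewrite subr0; exact: hr.
Qed.

Lemma has_germ_unique (h h' : H) (g : C -> W) :
  has_germ h g -> has_germ h' g -> h = h'.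
Proof.
move=> /has_germP[r1 r10 h1] /has_germP[r2 r20 h2].
have [r r0 hr] := rho_ball.
apply/eqP; rewrite -subr_eq0; apply/eqP; apply: (rk_identity hs).
apply/nbhs_rn; exists (Num.min r (Num.min r1 r2)); first by rewrite !lt_min r0 r10.
move=> w; rewrite subr0 !lt_min => /and3P[wr w1 w2].
by rewrite (linB (rk_eval_linear (hr w wr))) h1 // h2 // subrr.
Qed.

(** What the identity theorem is for: kernel vectors at points near 0, where the transfer function
    is known, are already total. *)
Lemma kf_total_near (r : R) (h : H) : 0 < r -> (forall w, rn w < r -> rho s w) ->
  (forall w f, rn w < r -> '[h, kf H w f] = 0) -> h = 0.
Proof.
move=> r0 hr h0; apply: (rk_identity hs); apply/nbhs_rn; exists r => // w.
rewrite subr0 => wr; apply: nondeg => f.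
by rewrite -(kf_rep f h (hr w wr)) h0.
Qed.

(** The relation between [e w f] and [kf H w f] is isometric and total on both sides, the side of
    [H] by [kf_total_near]. Read in each direction it gives both index inequalities and then two
    extensions, inverse to each other. *)
Lemma unitary_model (X : pontryagin R) (e : C -> W -> X) (r : R) :
  0 < r -> (forall w, rn w < r -> rho s w) ->
  (forall w z f g, rn w < r -> rn z < r ->
     '[e w f, e z g] = '[kf H w f, kf H z g]) ->
  (forall x, (forall w f, rn w < r -> '[x, e w f] = 0) -> x = 0) ->
  exists J : X -> H, [/\ linear J, forall x y, '[J x, J y] = '[x, y],
    forall h, exists x, J x = h &
    forall x w f, rn w < r -> '[rk_eval (J x) w, f] = '[x, e w f]].
Proof.
move=> r0 hr eg et.
pose E : set (X * H)%type :=
  [set p | exists w f, rn w < r /\ p = (e w f, kf H w f)].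
pose E' : set (H * X)%type :=
  [set p | exists w f, rn w < r /\ p = (kf H w f, e w f)].
have iE p p' : E p -> E p' -> '[p.1, p'.1] = '[p.2, p'.2].
  by move=> [w [f [rw ->]]] [z [g [rz ->]]]; exact: eg.
have iE' p p' : E' p -> E' p' -> '[p.1, p'.1] = '[p.2, p'.2].
  by move=> [w [f [rw ->]]] [z [g [rz ->]]]; rewrite /= eg.
have tE x : (forall p, E p -> '[x, p.1] = 0) -> x = 0.
  move=> hx; apply: et => w f wr.
  by apply: (hx (e w f, kf H w f)); exists w, f.
have tE' h : (forall p, E' p -> '[h, p.1] = 0) -> h = 0.
  move=> hx; apply: (kf_total_near r0 hr) => w f wr.
  by apply: (hx (kf H w f, e w f)); exists w, f.
have ind : neg_index X = neg_index H.
  apply/eqP; rewrite eqn_leq (relation_neg_index_le iE tE).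
  exact: relation_neg_index_le iE' tE'.
have [J [lJ _ iJ eJ]] := isometric_extension iE tE ind.
have [J' [lJ' _ iJ' eJ']] := isometric_extension iE' tE' (esym ind).
have Je w f : rn w < r -> J (e w f) = kf H w f.
  by move=> wr; apply: (eJ (e w f, kf H w f)); exists w, f.
have J'k w f : rn w < r -> J' (kf H w f) = e w f.
  by move=> wr; apply: (eJ' (kf H w f, e w f)); exists w, f.
exists J; split=> // [h|x w f wr].
  exists (J' h); apply/eqP; rewrite -subr_eq0; apply/eqP.
  apply: (kf_total_near r0 hr) => w f wr.
  by rewrite fBl -{1}(Je w f wr) iJ -(J'k w f wr) iJ' subrr.
by rewrite -(kf_rep f (J x) (hr w wr)) -(Je w f wr) iJ.
Qed.

End Germs.

Lemma holomorphic_at_near (U Y : hilbert R) (S : C -> U -> Y) z :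
  holomorphic_at S z -> exists2 r : R, 0 < r &
    forall w, rn (w - z) < r -> bop (S w) /\ op_derivable S w.
Proof. by move=> /nbhs_rn. Qed.

(** The derivative at w is the adjoint of the derivative of S at [w^*]: conjugating the point undoes
    the antilinearity of the adjoint, so the remainder is the adjoint of the remainder [D] of S. *)
Lemma sharp_holomorphic (U Y : hilbert R) (S : C -> U -> Y) :
  holomorphic_at S 0 -> holomorphic_at (sharp S) 0.
Proof.
move=> /holomorphic_at_near[r r0 hr]; apply/nbhs_rn; exists r => // w.
rewrite subr0 => wr.
have hr' z : rn z < r -> bop (S z^*) /\ op_derivable S z^*.
  by move=> zr; apply: hr; rewrite subr0 rn_conj.
have bS z : rn z < r -> bop (S z^*) by move=> /hr'[].
split; first exact: adjoint_bop (bS w wr).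
have [_ [T [bT dT]]] := hr' w wr.
have bw := bS w wr.
exists (adjoint T); split; first exact: adjoint_bop.
move=> e e0; have [m m0 hm] := adjoint_bound Y.
have e0' : 0 < re e by rewrite -lt_rc -ge0E // ltW.
(* Dividing by [m] compensates for the factor in [adjoint_bound]. *)
have em : 0 < re e / m by rewrite divr_gt0.
have em' : 0 < rc (re e / m) by rewrite -rc0 lt_rc.
have /nbhs_rn[d d0 Hd] := dT _ em'.
apply/nbhs_rn; exists (Num.min d (r - rn w)).
  by rewrite lt_min d0 subr_gt0.
move=> z; rewrite lt_min => /andP[zd zr] y.
have zr' : rn z < r by have := rnD (z - w) w; rewrite subrK; lra.
have bz := bS z zr'.
pose D u := S z^* u - S w^* u - (z^* - w^*) *: T u.
have hD u : rn (D u) <= re e / m * rn (z - w) * rn u.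
  have zw : rn (z^* - w^*) = rn (z - w) by rewrite -conjB rn_conj.
  have zd' : rn (z^* - w^*) < d by rewrite zw.
  by have := Hd z^* zd' u; rewrite !rnE -!rcM le_rc zw.
have lD : linear D.
  move=> a u v; rewrite /D bz.1 bw.1 bT.1 !scalerBr scalerDr !scalerA [a * _]mulrC.
  by rewrite !opprD [X in X + _ = _]addrACA [LHS]addrACA.
have bD := bopP lD hD.
have -> : sharp S z y - sharp S w y - (z - w) *: adjoint T y = adjoint D y.
  symmetry; apply: adjoint_unique => x.
  by rewrite /D !fBl !fBr fZl fZr conjB !adjointE.
rewrite !rnE (ge0E (ltW e0)) -!rcM le_rc.
have c0 : 0 <= re e / m * rn (z - w) by rewrite mulr_ge0 ?rn_ge0 ?(ltW em).
apply: le_trans (hm _ _ _ c0 bD hD y) _.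
by rewrite le_eqVlt (_ : _ == _) //; apply/eqP; field; rewrite gt_eqF.
Qed.

End Model.

(** * Systems *)

Section Resolvent.
Variable R : realType.
Notation C := (Cplx R).

Lemma half_pow_small (c M : R) : 0 <= c -> (forall n, c <= (2^-1) ^+ n * M) -> c = 0.
Proof.
move=> c0 hc; apply/eqP; rewrite eq_le c0 andbT leNgt; apply/negP => cp.
have lt12 : 1 < 2 :> R by rewrite ltr1n.
have [N HN] := exp_growth M lt12 cp.
have := HN N (leqnn N); rewrite ltNge => /negP; apply.
have := hc N; rewrite exprVn mulrC ler_pdivlMr ?exprn_gt0 // => h.
by rewrite mulrC.
Qed.

(** [u n] is the n-th partial sum of the Neumann series applied to y, obtained by iterating x |-> y
    + T x from 0. *)
Lemma neumann (X : completeNormedModType C) (T : X -> X) : linear T ->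
  (forall x, rn (T x) <= 2^-1 * rn x) -> forall y, exists x, x - T x = y.
Proof.
move=> lT bT y; pose u n := iter n (fun x => y + T x) 0.
have uS n : u n.+1 = y + T (u n) by [].
have u_le n : rn (u n) <= 2 * rn y.
  elim: n => [|n IH]; first by rewrite rn0 mulr_ge0 ?rn_ge0.
  rewrite uS; have := rnD y (T (u n)); have := bT (u n); lra.
have u_diff n k : rn (u (n + k)%N - u n) <= (2^-1) ^+ n * (2 * rn y).
  elim: n => [|n IH]; first by rewrite expr0 mul1r subr0 u_le.
  rewrite addSn !uS opprD addrACA subrr add0r -(linB lT).
  by apply: le_trans (bT _) _; rewrite exprS -mulrA ler_pM2l // invr_gt0.
have [l ul] : exists l, lim_seq u l.
  apply: lim_seq_cauchy => e e0.
  have lt12 : 1 < 2 :> R by rewrite ltr1n.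
  (* The 4 comes from two differences with [u N], each at most 2^-N times [2 * rn y]. *)
  have [N HN] := exp_growth (4 * rn y) lt12 e0.
  have hN : (2^-1) ^+ N * (4 * rn y) < e.
    by rewrite exprVn mulrC ltr_pdivrMr ?exprn_gt0 // [ltRHS]mulrC HN.
  exists N => i j Ni Nj; apply: le_lt_trans hN.
  have := u_diff N (i - N)%N; have := u_diff N (j - N)%N.
  rewrite !subnKC // => h1 h2.
  have -> : u i - u j = (u i - u N) - (u j - u N) by rewrite opprB addrA subrK.
  by apply: le_trans (rnB _ _) _; lra.
exists l; apply/eqP; rewrite -subr_eq0 -rn_eq0; apply/eqP.
apply: (@eq0_of_eps _ _ 2) (rn_ge0 _) _ => e e0.
have [N HN] := ul e e0.
have -> : l - T l - y = T (u N - l) - (u N.+1 - l).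
  rewrite uS (linB lT) opprB opprD [- y - _]addrC 2!addrA.
  by rewrite [T _ - _ + _]addrAC [T _ + _ - _ - _]addrAC [T _ + _]addrC addrK.
apply: le_trans (rnB _ _) _.
have := bT (u N - l); have := HN N (leqnn N); have := HN N.+1 (leqnSn N).
by have := rn_ge0 (u N - l); lra.
Qed.

Section OneOperator.
Variables (X : pontryagin R) (A : X -> X) (K : R).
Hypotheses (lA : linear A) (bA : forall x, rn (A x) <= K * rn x).

Lemma resolvent_bound (z : C) x y : rn z * K <= 2^-1 -> x - z *: A x = y ->
  rn x <= 2 * rn y.
Proof.
move=> zK <-; have := rnD (x - z *: A x) (z *: A x); rewrite subrK rnZ => h.
have : rn z * rn (A x) <= rn z * K * rn x.
  by rewrite -mulrA ler_wpM2l ?rn_ge0.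
have : rn z * K * rn x <= 2^-1 * rn x by rewrite ler_wpM2r ?rn_ge0.
lra.
Qed.

Lemma resolvent_unique (z : C) x x' : rn z * K <= 2^-1 ->
  x - z *: A x = x' - z *: A x' -> x = x'.
Proof.
move=> zK e; apply/eqP; rewrite -subr_eq0 -rn_eq0 eq_le rn_ge0 andbT.
rewrite -(mulr0 2) -(rn0 X); apply: (resolvent_bound zK).
rewrite (linB lA) scalerBr opprB addrA addrAC [x - x' - _]addrAC e.
by rewrite [x' - _ - _]addrAC subrr add0r addNr.
Qed.

Lemma resolvent_exists (z : C) y : rn z * K <= 2^-1 -> exists x, x - z *: A x = y.
Proof.
move=> zK; apply: neumann => [a x x'|x].
  by rewrite lA scalerDr !scalerA mulrC.
rewrite rnZ; have := bA x => h.
apply: le_trans (ler_wpM2l (rn_ge0 z) h) _.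
by rewrite mulrA ler_wpM2r ?rn_ge0.
Qed.

Lemma inverseP (z : C) y : rn z * K <= 2^-1 ->
  inverse (fun x => x - z *: A x) y - z *: A (inverse (fun x => x - z *: A x) y) = y.
Proof.
move=> zK; have [x hx] := resolvent_exists y zK.
exact: (@xgetI _ 0 [set x | x - z *: A x = y] x hx).
Qed.

Lemma inverse_eq (z : C) x y : rn z * K <= 2^-1 -> x - z *: A x = y ->
  inverse (fun x => x - z *: A x) y = x.
Proof.
by move=> zK e; apply: (resolvent_unique zK); rewrite inverseP.
Qed.

End OneOperator.

End Resolvent.

(** * States near 0 and controllability *)

Section System.
Variable R : realType.
Notation C := (Cplx R).

Section OneSystem.
Variables (X : pontryagin R) (U Y : hilbert R) (Sigma : system X U Y).
Local Notation A := (main_op Sigma).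
Local Notation B := (control_op Sigma).

(* [state w u] is (I - w^* A)^-1 B u; with this convention the Gram matrix of
   the states is the kernel K(w, z) of the sharp of the transfer function. *)
Definition state (w : C) (u : U) : X :=
  inverse (fun x => x - w^* *: A x) (B u).

Lemma main_op_bounded : exists2 K : R, 0 < K & forall x, rn (A x) <= K * rn x.
Proof. exact: bop_bounded (main_opP Sigma). Qed.

Lemma transferE w u :
  transfer Sigma w^* u =
  feedthrough_op Sigma u + w^* *: observation_op Sigma (state w u).
Proof. by []. Qed.

Lemma state_spec : exists2 r : R, 0 < r & forall w u, rn w < r ->
  state w u - w^* *: A (state w u) = B u.
Proof.
have [K K0 bA] := main_op_bounded; exists (2^-1 / K) => [|w u].
  by rewrite divr_gt0 ?invr_gt0.
rewrite ltr_pdivlMr // => /ltW wK.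
have wK' : rn w^* * K <= 2^-1 by rewrite rn_conj.
exact: (inverseP (main_opP Sigma).1 bA (B u) wK').
Qed.

Lemma state_eq : exists2 r : R, 0 < r & forall w u x, rn w < r ->
  x - w^* *: A x = B u -> state w u = x.
Proof.
have [K K0 bA] := main_op_bounded; exists (2^-1 / K) => [|w u x].
  by rewrite divr_gt0 ?invr_gt0.
rewrite ltr_pdivlMr // => /ltW wK.
have wK' : rn w^* * K <= 2^-1 by rewrite rn_conj.
exact: (inverse_eq (main_opP Sigma).1 bA wK').
Qed.

Lemma state0 u : state 0 u = B u.
Proof.
have [r r0 hr] := state_eq; apply: hr; first by rewrite rn0.
by rewrite conjC0 scale0r subr0.
Qed.

Lemma state_gram : isometric Sigma -> exists2 r : R, 0 < r &
  forall w z u u', rn w < r -> rn z < r ->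
  (1 - z * w^*) * '[state w u, state z u'] =
  '[u, u'] - '[transfer Sigma w^* u, transfer Sigma z^* u'].
Proof.
move=> /isometricP iS; have [r r0 hr] := state_spec; exists r => // w z u u' wr zr.
have TE v x : rn v < r ->
    system_operator Sigma (v^* *: state v x, x) = (state v x, transfer Sigma v^* x).
  move=> vr; rewrite transferE /system_operator /=.
  rewrite (linZ (main_opP Sigma).1) (linZ (observation_opP Sigma).1).
  by rewrite -(hr v x vr) addrC subrK [X in (_, X)]addrC.
have := iS (w^* *: state w u, u) (z^* *: state z u', u').
rewrite !TE // !psumE /= fZl fZr conjCK => e.
rewrite mulrBl mul1r; apply/eqP; rewrite subr_eq addrAC eq_sym subr_eq e.
by apply/eqP; ring.
Qed.

(** States satisfy w^* A e_w u = e_w u - e_0 u with e_0 u = B u, the identity that [moments]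
    requires. *)
Lemma moments_state x : (exists2 r : R, 0 < r &
    forall w u, rn w < r -> '[x, state w u] = 0) ->
  forall n u, '[x, iter n A (B u)] = 0.
Proof.
move=> [r' r'0 hx] n u.
have [K K0 bA] := main_op_bounded; have lA := (main_opP Sigma).1.
pose r := Num.min r' (2^-1 / K).
have r0 : 0 < r by rewrite lt_min r'0 divr_gt0 ?invr_gt0.
have rK w : rn w < r -> rn w^* * K <= 2^-1.
  by rewrite rn_conj lt_min ltr_pdivlMr // => /andP[_ /ltW].
rewrite -state0 -fC; apply/eqP; rewrite conjC_eq0; apply/eqP.
have spec w : rn w < r -> state w u - w^* *: A (state w u) = B u.
  by move=> wr; exact: (inverseP lA bA (B u) (rK w wr)).
apply: (@moments _ _ A K r (fun w => state w u) x lA K0 bA r0).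
(* A Lipschitz constant of the state at 0, increased by 1 to be positive. *)
- move=> e e0; set L := K * (2 * rn (B u)) + 1.
  have L0 : 0 < L by rewrite ltr_wpDl // !mulr_ge0 ?rn_ge0 // ltW.
  exists (Num.min r (e / L)); first by rewrite lt_min r0 divr_gt0.
  move=> w; rewrite subr0 lt_min => /andP[wr we].
  have -> : state w u - state 0 u = w^* *: A (state w u).
    by rewrite state0 -(spec w wr) opprB addrC subrK.
  have sb : rn (state w u) <= 2 * rn (B u).
    exact: (resolvent_bound bA (rK w wr) (spec w wr)).
  rewrite rnZ rn_conj; move: we; rewrite ltr_pdivlMr //; apply: le_lt_trans.
  rewrite ler_wpM2l ?rn_ge0 //; apply: le_trans (bA _) _; rewrite /L.
  apply: le_trans (_ : K * (2 * rn (B u)) <= _); last by rewrite lerDl.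
  by rewrite ler_pM2l.
- by move=> w wr; rewrite state0 -(spec w wr) opprB addrC subrK.
- by move=> w; rewrite lt_min => /andP[wr _]; rewrite -fC hx ?conjC0.
Qed.

(** Applying A^n to the equation of the state shows that its product with x is w^n times that of A^n
    e_w u, hence O(2^-n) for small w. *)
Lemma state_moments x : (forall n u, '[x, iter n A (B u)] = 0) ->
  exists2 r : R, 0 < r & forall w u, rn w < r -> '[x, state w u] = 0.
Proof.
move=> hx; have [K K0 bA] := main_op_bounded; have lA := (main_opP Sigma).1.
exists (2^-1 / K) => [|w u]; first by rewrite divr_gt0 ?invr_gt0.
rewrite ltr_pdivlMr // => /ltW wK.
have wK' : rn w^* * K <= 2^-1 by rewrite rn_conj.
have spec : state w u - w^* *: A (state w u) = B u.
  exact: (inverseP lA bA (B u) wK').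
have [m m0 fm] := form_bounded X.
have stepn n : '[x, iter n A (state w u)] = w * '[x, iter n.+1 A (state w u)].
  have lAn := iter_linear n lA.
  have : '[x, iter n A (state w u - w^* *: A (state w u))] = 0 by rewrite spec hx.
  rewrite (linB lAn) (linZ lAn) fBr fZr conjCK -iterSr => /eqP.
  by rewrite subr_eq0 => /eqP.
have powE n : '[x, state w u] = w ^+ n * '[x, iter n A (state w u)].
  elim: n => [|n IH]; first by rewrite expr0 mul1r.
  by rewrite IH stepn mulrA -exprSr.
apply/eqP; rewrite -rn_eq0; apply/eqP.
apply: (@half_pow_small _ _ (m * rn x * rn (state w u)) (rn_ge0 _)) => n.
rewrite (powE n) rnM rnX.
apply: le_trans (ler_wpM2l (exprn_ge0 n (rn_ge0 w)) (fm _ _)) _.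
have := iter_bounded n K0 bA (state w u) => h.
have M0 : 0 <= rn w ^+ n * (m * rn x) by rewrite !mulr_ge0 ?exprn_ge0 ?rn_ge0 // ltW.
rewrite mulrA; apply: le_trans (ler_wpM2l M0 h) _.
rewrite [leLHS](_ : _ = (rn w * K) ^+ n * (m * rn x * rn (state w u))); last first.
  by rewrite exprMn; ring.
rewrite ler_wpM2r ?mulr_ge0 ?rn_ge0 ?(ltW m0) //.
by rewrite lerXn2r ?nnegrE ?mulr_ge0 ?rn_ge0 ?invr_ge0 ?(ltW K0).
Qed.

(** A subspace may meet its orthogonal complement here, but by [total_dense] a trivial complement
    still means density. *)
Lemma controllableP : controllable Sigma <->
  forall x, (forall n u, '[x, iter n A (B u)] = 0) -> x = 0.
Proof.
rewrite /controllable.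
have GE x : (forall n u, '[x, iter n A (B u)] = 0) <->
    (forall y, lspan [set x | exists (n : nat) (u : U), x = iter n A (B u)] y ->
      '[x, y] = 0).
  split=> [hx|hx n u].
    apply: (@lspan_min _ _ _ [set y | '[x, y] = 0]) => [|_ [n [u ->]]].
      split; first exact: f0r.
      by move=> a y y' /= h h'; rewrite fDr fZr h h' mulr0 addr0.
    exact: hx.
  by apply: hx; apply: sub_lspan; exists n, u.
split=> [cl x /GE hx|tot].
  apply: nondeg; apply: near_dense_total hx => y e e0.
  have /closure_rn : closure (lspan [set x | exists (n : nat) (u : U),
    x = iter n A (B u)]) y by rewrite cl.
  by move=> /(_ e e0).
apply/seteqP; split=> // y _; apply/closure_rn => e e0.
apply: total_dense e0; first exact: lspan_subspace.
move=> x hx; apply: tot; apply/GE => z zG.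
by rewrite -fC hx ?conjC0.
Qed.

End OneSystem.

End System.

(** * Realizations and products *)

Section Realization.
Variable R : realType.
Notation C := (Cplx R).

Lemma realizesP (X : pontryagin R) (U Y : hilbert R) (Sigma : system X U Y)
    (S : C -> U -> Y) :
  realizes Sigma S <-> exists2 r : R, 0 < r &
    forall z, rn z < r -> transfer Sigma z = S z.
Proof.
split=> [/nbhs_rn[r r0 hr]|[r r0 hr]].
  by exists r => // z zr; apply: hr; rewrite subr0.
by apply/nbhs_rn; exists r => // z; rewrite subr0; exact: hr.
Qed.

Lemma adjoint_sharp (U Y : hilbert R) (S : C -> U -> Y) : holomorphic_at S 0 ->
  exists2 r : R, 0 < r & forall w, rn w < r -> bop (S w) /\
    adjoint (sharp S w) = S w^*.
Proof.
move=> /holomorphic_at_near[r r0 hr]; exists r => // w wr.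
have bS z : rn z < r -> bop (S z) by move=> zr; have [] := hr z; rewrite ?subr0.
split; first exact: bS.
by apply: adjointK; apply: bS; rewrite rn_conj.
Qed.

Lemma system_model (X : pontryagin R) (U Y : hilbert R) (Sigma : system X U Y)
    (S : C -> U -> Y) (H : rkps (sharp S)) :
  isometric Sigma -> controllable Sigma -> realizes Sigma S ->
  holomorphic_at S 0 ->
  exists J : X -> H, [/\ linear J, forall x y, '[J x, J y] = '[x, y],
    forall h, exists x, J x = h &
    exists2 r : R, 0 < r & forall x w u, rn w < r ->
      '[rk_eval (J x) w, u] = '[x, state Sigma w u]].
Proof.
move=> iS /controllableP cS /realizesP[r1 r10 h1] hS.
have hsh := sharp_holomorphic hS.
have [r2 r20 h2] := adjoint_sharp hS; have [r3 r30 h3] := state_gram iS.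
have [r4 r40 h4] := rho_ball hsh.
pose r := Num.min 1 (Num.min r1 (Num.min r2 (Num.min r3 r4))).
have r0 : 0 < r by rewrite !lt_min ltr01 r10 r20 r30.
have rE (w : C) : rn w < r ->
    [/\ rn w < 1, rn w < r1, rn w < r2, rn w < r3 & rn w < r4].
  by rewrite !lt_min => /and5P[].
have hr w : rn w < r -> rho (sharp S) w by move=> /rE[_ _ _ _ /h4].
have [J [lJ iJ sJ eJ]] : exists J : X -> H, [/\ linear J,
    forall x y, '[J x, J y] = '[x, y], forall h, exists x, J x = h &
    forall x w f, rn w < r -> '[rk_eval (J x) w, f] = '[x, state Sigma w f]].
  apply: (unitary_model hsh r0 hr) => [w z u u' wr zr|x hx].
    have [w1 wr1 wr2 wr3 _] := rE w wr; have [z1 zr1 zr2 zr3 _] := rE z zr.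
    rewrite (kf_gram H u u' (hr w wr) (hr z zr)) /gram.
    rewrite (h2 w wr2).2 (h2 z zr2).2 -!h1 ?rn_conj //.
    by rewrite -(h3 w z u u' wr3 zr3) mulrA mulVf ?mul1r // one_sub_neq0.
  by apply: cS; apply: moments_state; exists r.
exists J; split=> //; exists r => // x w u; exact: eJ.
Qed.

Section Product.
Variables (U Y1 Y : hilbert R) (X1 X2 : pontryagin R).
Variables (Sigma1 : system X1 U Y1) (Sigma2 : system X2 Y1 Y).
Local Notation Sigma := (product_system Sigma2 Sigma1).

(** A cascade: the operator of [Sigma1], then that of [Sigma2] fed with its output, each extended by
    the identity on the other state space. Isometry is inherited from the two factors. *)
Lemma product_operator v :
  system_operator Sigma v =
  let p := system_operator Sigma1 (v.1.1, v.2) in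
  let r := system_operator Sigma2 (v.1.2, p.2) in ((p.1, r.1), r.2).
Proof.
have lB2 := (control_opP Sigma2).1; have lD2 := (feedthrough_opP Sigma2).1.
rewrite /system_operator /= (linD lB2) (linD lD2); congr ((_, _), _).
  by rewrite addrAC addrC addrA.
by rewrite addrAC addrC addrA.
Qed.

Lemma product_isometric : isometric Sigma1 -> isometric Sigma2 -> isometric Sigma.
Proof.
move=> /isometricP i1 /isometricP i2; apply/isometricP => v w.
rewrite !product_operator.
set p := system_operator Sigma1 _; set p' := system_operator Sigma1 _.
have h1 := i1 (v.1.1, v.2) (w.1.1, w.2).
have h2 := i2 (v.1.2, p.2) (w.1.2, p'.2).
move: h1 h2; rewrite !psumE -/p -/p' /= => h1 h2.
by rewrite -addrA h2 addrCA h1; ring.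
Qed.

Lemma state_product : exists2 r : R, 0 < r & forall w u, rn w < r ->
  state Sigma w u = (state Sigma1 w u, state Sigma2 w (transfer Sigma1 w^* u)).
Proof.
have [r1 r10 h1] := state_spec Sigma1; have [r2 r20 h2] := state_spec Sigma2.
have [r3 r30 h3] := state_eq Sigma.
exists (Num.min r1 (Num.min r2 r3)); first by rewrite !lt_min r10 r20.
move=> w u; rewrite !lt_min => /and3P[w1 w2 w3]; apply: h3 => //=.
have lB2 := (control_opP Sigma2).1.
congr pair => /=; first exact: h1.
rewrite scalerDr opprD addrA [_ - _ - _]addrAC h2 // transferE.
by rewrite (linD lB2) (linZ lB2) addrK.
Qed.

Lemma product_transfer : exists2 r : R, 0 < r & forall z, rn z < r ->
  transfer Sigma z = transfer Sigma2 z \o transfer Sigma1 z.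
Proof.
have [r r0 hr] := state_product; exists r => // z zr; apply/funext => u /=.
rewrite -(conjCK z) !transferE hr ?rn_conj //=.
have lD2 := (feedthrough_opP Sigma2).1.
by rewrite transferE (linD lD2) (linZ lD2) scalerDr addrA.
Qed.

End Product.

End Realization.

(* S ranges over all meromorphic functions equal to S2 S1 near 0, the pointwise
   product among them; H, H1, H2 are the spaces H(S#), H(S1#), H(S2#). *)
Theorem theorem3p7 (R : realType) (U Y1 Y : hilbert R) (X1 X2 : pontryagin R)
    (kappa1 kappa2 : nat)
    (X1_index : neg_index X1 = kappa1) (X2_index : neg_index X2 = kappa2)
    (Sigma1 : system X1 U Y1) (Sigma2 : system X2 Y1 Y)
    (S1 : Cplx R -> U -> Y1) (S2 : Cplx R -> Y1 -> Y)
    (S1_schur : gen_schur kappa1 S1) (S2_schur : gen_schur kappa2 S2)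
    (Sigma1_isometric : isometric Sigma1)
    (Sigma1_controllable : controllable Sigma1)
    (Sigma1_realizes : realizes Sigma1 S1)
    (Sigma2_isometric : isometric Sigma2)
    (Sigma2_controllable : controllable Sigma2)
    (Sigma2_realizes : realizes Sigma2 S2)
    (S : Cplx R -> U -> Y)
    (S_meromorphic : meromorphic S) (S_holomorphic : holomorphic_at S 0)
    (S_product : \forall z \near (0 : Cplx R), S z = S2 z \o S1 z)
    (H : rkps (sharp S)) (H1 : rkps (sharp S1)) (H2 : rkps (sharp S2)) :
  [/\ isometric (product_system Sigma2 Sigma1),
      controllable (product_system Sigma2 Sigma1)
    & realizes (product_system Sigma2 Sigma1) S] <->
  space_decomposition H H1 H2 /\
  multiplication_isometry S1 H H2.
Proof.
have [_ hS1 _] := S1_schur; have [_ hS2 _] := S2_schur.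
set Sigma := product_system Sigma2 Sigma1.
have iSigma : isometric Sigma by exact: product_isometric.
have [r1 r10 t1] := (realizesP Sigma1 S1).1 Sigma1_realizes.
have [r2 r20 t2] := (realizesP Sigma2 S2).1 Sigma2_realizes.
have rSigma : realizes Sigma S.
  apply/realizesP; have [r3 r30 t3] := product_transfer Sigma1 Sigma2.
  have /nbhs_rn[r4 r40 t4] := S_product.
  exists (Num.min (Num.min r1 r2) (Num.min r3 r4)).
    by rewrite !lt_min r10 r20 r30.
  move=> z; rewrite !lt_min => /andP[/andP[z1 z2] /andP[z3 z4]].
  by rewrite t3 // t1 // t2 // t4 // subr0.
have [J1 [_ iJ1 sJ1 [r3 r30 eJ1]]] :=
  system_model H1 Sigma1_isometric Sigma1_controllable Sigma1_realizes hS1.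
have [J2 [_ iJ2 sJ2 [r4 r40 eJ2]]] :=
  system_model H2 Sigma2_isometric Sigma2_controllable Sigma2_realizes hS2.
have [r5 r50 t5] := adjoint_sharp hS1.
have [r6 r60 t6] := state_product Sigma1 Sigma2.
pose r := Num.min (Num.min r1 r3) (Num.min r4 (Num.min r5 r6)).
have r0 : 0 < r by rewrite !lt_min r10 r30 r40 r50.
pose germ2 (x2 : X2) := Defs.mul_fun (sharp S1) (rk_eval (J2 x2)).
(* Products with states of the product system are values near 0 of J1 x1 + S1# J2 x2; the adjoint
   takes S1(w^* ) off the input of [Sigma2] and puts it on the function. *)
have stateE w u (x : psum X1 X2) : rn w < r ->
    '[x, state Sigma w u] =
    '[rk_eval (J1 x.1) w, u] + '[germ2 x.2 w, u].
  rewrite !lt_min => /andP[/andP[w1 w3] /and3P[w4 w5 w6]].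
  rewrite t6 // psumE /= t1 ?rn_conj // eJ1 //; congr (_ + _).
  rewrite /germ2 /Defs.mul_fun /sharp -eJ2 // adjointE' //.
  by apply: (t5 w^* _).1; rewrite rn_conj.
have hsh := sharp_holomorphic S_holomorphic.
split=> [[_ cSigma _]|[[c1 c2 c3 [_ o2 _]] mi]].
  have [J [lJ iJ sJ [r7 r70 eJ]]] :=
    system_model H iSigma cSigma rSigma S_holomorphic.
  have J1_0 w : rn w < r -> rk_eval (J1 0) w = 0.
    rewrite !lt_min => /andP[/andP[w1 w3] _]; apply: nondeg => u.
    by rewrite eJ1 // f0l.
  have J2_0 w : rn w < r -> germ2 0 w = 0.
    move=> wr; apply: nondeg => u.
    have := stateE w u 0 wr; rewrite f0l J1_0 // f0l add0r.
    by move=> <-.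
  have germJ (x : psum X1 X2) w : rn w < Num.min r r7 ->
      rk_eval (J x) w = rk_eval (J1 x.1) w + germ2 x.2 w.
    rewrite lt_min => /andP[wr w7]; apply: form_inj => u.
    by rewrite eJ // stateE // fDl.
  have min0 : 0 < Num.min r r7 by rewrite lt_min r0.
  have g1 x1 : has_germ (J (x1, 0)) (rk_eval (J1 x1)).
    apply/has_germP; exists (Num.min r r7) => // w wr.
    by rewrite germJ //= J2_0 ?addr0 //; move: wr; rewrite lt_min => /andP[].
  have g2 x2 : has_germ (J (0, x2)) (germ2 x2).
    apply/has_germP; exists (Num.min r r7) => // w wr.
    by rewrite germJ //= J1_0 ?add0r //; move: wr; rewrite lt_min => /andP[].
  (* By the identity theorem a germ belongs to at most one element of [H]. *)
  have u1 h x1 : has_germ h (rk_eval (J1 x1)) -> h = J (x1, 0).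
    by move=> hg; exact: (has_germ_unique hsh hg (g1 x1)).
  have u2 h x2 : has_germ h (germ2 x2) -> h = J (0, x2).
    by move=> hg; exact: (has_germ_unique hsh hg (g2 x2)).
  split; last first.
    move=> h2 h2' h h'; have [x2 <-] := sJ2 h2; have [x2' <-] := sJ2 h2'.
    by move=> /u2 -> /u2 ->; rewrite iJ iJ2 psumE /= f0l add0r.
  split.
  - by move=> h2; have [x2 <-] := sJ2 h2; exists (J (0, x2)); exact: g2.
  - by move=> h1; have [x1 <-] := sJ1 h1; exists (J (x1, 0)); exact: g1.
  - move=> h1 h1' h h'; have [x1 <-] := sJ1 h1; have [x1' <-] := sJ1 h1'.
    by move=> /u1 -> /u1 ->; rewrite iJ iJ1 psumE /= f0l addr0.
  split.
  - move=> m n [h2 + [h1]]; have [x2 <-] := sJ2 h2; have [x1 <-] := sJ1 h1.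
    by move=> /u2 -> /u1 ->; rewrite iJ psumE /= f0l f0r addr0.
  - move=> x [h2 + [h1]]; have [x2 <-] := sJ2 h2; have [x1 <-] := sJ1 h1.
    (* J preserves a nondegenerate form and is injective, so (0, x2) = (x1, 0) and the common
       element is J 0. *)
    move=> /u2 -> /u1 e.
    have : (0, x2) = (x1, 0) :> psum X1 X2.
      by apply: form_inj => y; rewrite -iJ e iJ.
    by move=> [_ ->]; exact: lin0 lJ.
  - move=> h; have [[x1 x2] <-] := sJ h.
    exists (J (0, x2)), (J (x1, 0)); split.
    + by exists (J2 x2); exact: g2.
    + by exists (J1 x1); exact: g1.
    + by rewrite -(linD lJ); congr J; congr pair; rewrite ?add0r ?addr0.
split=> //; apply/controllableP => -[x1 x2] hx.
have [r7 r70 hx7] := state_moments hx.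
have J1E w u : rn w < r -> '[rk_eval (J1 (- x1)) w, u] = - '[rk_eval (J1 x1) w, u].
  by rewrite !lt_min => /andP[/andP[w1 w3] _]; rewrite !eJ1 // fNl.
(* Orthogonality to the states says that S1# J2 x2 and J1 (- x1) agree near 0, so [h] lies in both
   summands. *)
have [h hg] := c1 (J2 x2).
have hg1 : has_germ h (rk_eval (J1 (- x1))).
  have [r8 r80 h8] := (has_germP _ _).1 hg.
  apply/has_germP; exists (Num.min r (Num.min r7 r8)).
    by rewrite lt_min r0 lt_min r70.
  move=> w; rewrite lt_min => /andP[wr]; rewrite lt_min => /andP[w7 w8].
  rewrite h8 //.
  apply: form_inj => u; rewrite J1E //; apply/eqP.
  by rewrite -addr_eq0 addrC -(stateE w u (x1, x2) wr) hx7.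
have h0 : h = 0 by apply: o2; [exists (J2 x2)|exists (J1 (- x1))].
(* Condition (ii) computes products of [x2] in [H] as products of [h = 0]; for [x1] the agreement of
   the inner products on H(S1#) does the same. *)
have x20 : x2 = 0.
  apply: nondeg => y; have [h' hg'] := c1 (J2 y).
  by rewrite -iJ2 -(mi _ _ _ _ hg hg') h0 f0l.
have x10 : - x1 = 0.
  apply: nondeg => y; have [h' hg'] := c2 (J1 y).
  by rewrite -iJ1 -(c3 _ _ _ _ hg1 hg') h0 f0l.
by rewrite x20 -[x1]opprK x10 oppr0.
Qed.
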